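(* Let $D\subset\mathbb T^2_P$ be a domain whose boundary has positive capacity. For a closed curve $\hat\gamma$ in $D$, let $n_1,n_1'\in\mathbb Z$ be the integers such that $\hat\gamma$ is homologous in $\mathbb T^2_P$ to the cycle $n_1\gamma_1+n_1'\gamma_1'$. 1. If there is no closed curve $\hat\gamma$ in $D$ with $n_1\ne0$, then $\phi^{-1}(D)=\bigcup_{j=-\infty}^{\infty}G_j$, where $G_0$ is an arbitrary connected component of $\phi^{-1}(D)$, $G_j=T^jG_0$, and $G_j\cap G_l=\emptyset$ for $j\ne l$. 2. If there exists a closed curve $\hat\gamma$ in $D$ with $n_1\neq0$, let $k=\min|n_1|$, the minimum being taken over all closed curves in $D$ with $n_1\ne0$. Then $\phi^{-1}(D)=\bigcup_{q=0}^{k-1}G_q$, where $G_0$ is an arbitrary connected component of $\phi^{-1}(D)$, the sets $G_0,\dots,G_{k-1}$ are pairwise disjoint $T^k$-homogeneous domains, and for every $m\in\mathbb Z$ one has $T^mG_0=G_q$ whenever $m=lk+q$ with $l,q\in\mathbb Z$, $0\le q\le k-1$.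
   Context: Fix $T>1$ and put $P=\log T$. $\mathbb T^2_P=\mathbb C/(P\mathbb Z+2\pi i\mathbb Z)$ is the torus obtained by identifying opposite sides of the rectangle $(0,P)\times(-\pi,\pi)$, with coordinate $z=x+iy$. Its first homology group has as basis the cycles $\gamma_1=\mathbb T^2_P\cap\{y=0\}$ and $\gamma_1'=\mathbb T^2_P\cap\{x=0\}$. Let $\pi:\mathbb C\to\mathbb T^2_P$ be the covering map and $\phi=\pi\circ\log:\mathbb C\setminus\{0\}\to\mathbb T^2_P$; $\phi$ is a well-defined covering map whose deck transformations are the dilations by $T^m$, $m\in\mathbb Z$. For $S>1$, an $S$-homogeneous domain is a nonempty connected open set $G\subset\mathbb C$ with $SG=G$. Capacity is logarithmic capacity. *)

(* Defs.v *)
From HB Require Import structures.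
From mathcomp Require Import all_boot all_order all_algebra.
From mathcomp Require Import generic_quotient.
From mathcomp Require Export complex.
From mathcomp Require Import all_classical all_reals all_analysis.

Set Implicit Arguments.
Unset Strict Implicit.
Unset Printing Implicit Defensive.
Import Order.TTheory GRing.Theory Num.Theory.
Import numFieldNormedType.Exports.
Local Open Scope classical_set_scope.
Local Open Scope complex_scope.
Local Open Scope ring_scope.

(* The usual topology of the complex plane, that of the modulus. *)
HB.instance Definition _ (R : realType) := NormedModule.copy R[i] R[i]^o.

Definition domain (X : topologicalType) (U : set X) : Prop :=
  [/\ U !=set0, open U & connected U].

Definition boundary (X : topologicalType) (U : set X) : set X :=
  closure U `\` interior U.

Definition is_component (X : topologicalType) (A G : set X) : Prop :=
  exists2 x, A x & G = connected_component A x.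

Section Plane.
Context {R : realType}.
Implicit Types (z w : R[i]) (S : R) (G E : set R[i]).

Definition dilate S G : set R[i] := [set S%:C * z | z in G].

Definition homogeneous_domain S G : Prop :=
  [/\ 1 < S, domain G & dilate S G = G].

(* The principal branch, with values in ]-pi, pi]; junk at 0. *)
Definition carg z : R :=
  let a := acos (complex.Re z / Normc.normc z) in
  if 0 <= complex.Im z then a else - a.

Definition clog z : R[i] := ln (Normc.normc z) +i* carg z.

Definition borelC : Type := g_sigma_algebraType (@open R[i]).
HB.instance Definition _ := Measurable.on borelC.

Local Open Scope ereal_scope.

(* [lne 0 = -oo], so atoms have energy [-oo]. *)
Definition energy (mu : probability borelC R) : \bar R :=
  \int[mu]_(z in setT) \int[mu]_(w in setT)
     lne (Normc.normc ((z : R[i]) - (w : R[i]))%R)%:E.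

(* Logarithmic capacity: sup of exp(energy) over the Borel probability
   measures with compact support contained in E; the added 0 is the usual
   convention for the empty set. *)
Definition capacity E : \bar R :=
  ereal_sup (0 |` [set expeR (energy mu) | mu in
    [set mu : probability borelC R |
       exists K : set R[i], [/\ compact K, K `<=` E & mu K = 1]]]).

End Plane.

(* First singular homology. The standard 1-simplex is identified with [0, 1]
   and the standard 2-simplex with {(s, t) | 0 <= s, 0 <= t, s + t <= 1}, with
   vertices (0, 0), (1, 0), (0, 1) in this order. Singular simplices are total
   functions of which only the restriction to the standard simplex matters. *)
Section Homology.
Context {R : realType} {X : topologicalType}.

Definition simplex1 : set R := `[0, 1].
Definition simplex2 : set (R * R) :=
  [set p | [/\ 0 <= p.1, 0 <= p.2 & p.1 + p.2 <= 1]].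

Definition singular1 (sigma : R -> X) : Prop :=
  {within simplex1, continuous sigma}.
Definition singular2 (sigma : R * R -> X) : Prop :=
  {within simplex2, continuous sigma}.

(* A singular 1-chain is represented by its coefficient function, which takes
   the same value on functions that agree on [0, 1]; [gen sigma] is the
   generator attached to the simplex sigma. *)
Definition chain1 : Type := (R -> X) -> int.
HB.instance Definition _ := GRing.Zmodule.on chain1.

Definition gen (sigma : R -> X) : chain1 :=
  fun tau => (`[< forall t, simplex1 t -> sigma t = tau t >] : nat)%:Z.

Definition bd2 (sigma : R * R -> X) : chain1 :=
  gen (fun t => sigma (1 - t, t)) - gen (fun t => sigma (0, t))
  + gen (fun t => sigma (t, 0)).

Definition homologous (c d : chain1) : Prop :=
  exists (N : nat) (m : 'I_N -> int) (sigma : 'I_N -> R * R -> X),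
    (forall i, singular2 (sigma i)) /\
    c - d = \sum_(i < N) bd2 (sigma i) *~ m i.

Definition closed_curve_in (D : set X) (gamma : R -> X) : Prop :=
  [/\ singular1 gamma, gamma 0 = gamma 1 &
      forall t, simplex1 t -> D (gamma t)].

End Homology.

Section Torus.
Context {R : realType}.
Implicit Type P : R.

Definition torus_rel P (z w : R[i]) : bool :=
  `[< exists m n : int, z = w + ((P *~ m) +i* ((pi *+ 2) *~ n)) >].

Lemma torus_rel_equiv P : equiv_class_of (torus_rel P).
Proof.
split.
- move=> z; apply/asboolP; exists 0, 0.
  by rewrite !mulr0z [X in _ + X](_ : _ = 0) ?addr0.
- have h z w : torus_rel P z w -> torus_rel P w z.
    move=> /asboolP [m [n ->]]; apply/asboolP; exists (- m), (- n).
    by case: w => a b; apply/eqP; rewrite eq_complex/= !mulrNz !addrK !eqxx.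
  by move=> z w; apply/idP/idP; apply: h.
- move=> y x z /asboolP [m [n ->]] /asboolP [m' [n' ->]].
  apply/asboolP; exists (m' + m), (n' + n).
  by case: z => a b; apply/eqP; rewrite eq_complex/= !mulrzDr !addrA !eqxx.
Qed.

Definition torus_equiv P : equiv_rel R[i] :=
  EquivRelPack (torus_rel_equiv P).

(* C / (P Z + 2 pi i Z) *)
Definition torus P : topologicalType :=
  quotient_topology {eq_quot (torus_equiv P)}%qT.

Definition torus_proj P (z : R[i]) : torus P :=
  (\pi_(quotient_topology {eq_quot (torus_equiv P)}%qT) z)%qT.

(* Only meaningful on C \ {0}. *)
Definition phi P (z : R[i]) : torus P := torus_proj P (clog z).

Definition phi_preimage P (D : set (torus P)) : set R[i] :=
  [set z | z != 0 /\ D (phi P z)].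

(* Polar sets being preserved by locally biholomorphic maps, the capacity of a
   subset of the torus is tested on its lift to C. *)
Definition positive_capacity P (E : set (torus P)) : Prop :=
  (0 < capacity (torus_proj P @^-1` E))%E.

Definition gamma1 P (t : R) : torus P := torus_proj P ((t * P) +i* 0).
Definition gamma1' P (t : R) : torus P := torus_proj P (0 +i* (t * (pi *+ 2))).

Definition homology_coords P (gamma : R -> torus P) (n n' : int) : Prop :=
  homologous (gen gamma) (gen (gamma1 P) *~ n + gen (gamma1' P) *~ n').

(* The values taken by n_1 over all closed curves in D. *)
Definition n1_values P (D : set (torus P)) : set int :=
  [set n | exists (gamma : R -> torus P) (n' : int),
     closed_curve_in D gamma /\ homology_coords gamma n n'].

End Torus.

(* Main.v *)
Require Import Defs.
From HB Require Import structures.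
From mathcomp Require Import all_boot all_order all_algebra.
From mathcomp Require Import generic_quotient.
From mathcomp Require Import ring lra zify.
From mathcomp Require Import all_classical all_reals all_analysis.
Import Order.TTheory GRing.Theory Num.Theory.
Import numFieldNormedType.Exports.
Local Open Scope classical_set_scope.
Local Open Scope ring_scope.

(* Write E for the equivalence relation "in the same component of A", where A
   is the lift of D. Since phi is open and its fibres are the orbits of the
   dilations by T^m, connectedness of D forces every point of A to be
   E-equivalent to a dilate of any other one. The set H of the n such that
   E z (T^n z) is then a subgroup of Z that does not depend on z, and both
   parts of the theorem describe the cosets of H in Z.

   H is the set of values of n_1. A path in A from z to T^n z projects to a
   closed curve in D, whose logarithm increases by n log T + 2 pi i b; a path
   in C whose increment is a period is homologous, modulo the period lattice,
   to a straight segment, and segments are additive in the period. Conversely,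
   a closed curve in D lifts to C, and the increment of the real part of lifts
   extends to a functional on chains that kills boundaries, because singular
   2-simplices lift to C as well; hence exp of the lift joins some w to T^n w
   in A.

   Lifts are built by adding up, along a contraction, the arcsines of the small
   rotations between successive values of a map to the circle. *)

(** * The complex plane as a product *)

Section Plane.
Local Open Scope complex_scope.
Context {R : realType}.
Implicit Types z w : R[i].
Local Notation Re := (@complex.Re R).
Local Notation Im := (@complex.Im R).

Lemma normc_le z : Normc.normc z <= `|Re z| + `|Im z|.
Proof.
case: z => a b /=; rewrite -[leRHS]ger0_norm ?addr_ge0// -sqrtr_sqr.
rewrite ler_sqrt ?sqr_ge0// sqrrD !real_normK ?num_real// lerD2r lerDl.
by rewrite mulrn_wge0// mulr_ge0.
Qed.

Lemma Re_le_normc z : `|Re z| <= Normc.normc z.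
Proof.
case: z => a b /=; rewrite -sqrtr_sqr ler_sqrt ?addr_ge0 ?sqr_ge0//.
by rewrite lerDl sqr_ge0.
Qed.

Lemma Im_le_normc z : `|Im z| <= Normc.normc z.
Proof.
case: z => a b /=; rewrite -sqrtr_sqr ler_sqrt ?addr_ge0 ?sqr_ge0//.
by rewrite lerDr sqr_ge0.
Qed.

(** Balls of [R[i]] have complex radii, a positive one being a positive real. Boxes with a real
    half-side are cofinal with them, and they reduce continuity in the plane to continuity of the
    two coordinates. *)
Lemma nbhs_box z (A : set R[i]) :
  nbhs z A <-> exists2 e : R, 0 < e &
    forall w, `|Re w - Re z| < e -> `|Im w - Im z| < e -> A w.
Proof.
have ReB u v : Re (u - v) = Re u - Re v by case: u v => [? ?] [? ?].
have ImB u v : Im (u - v) = Im u - Im v by case: u v => [? ?] [? ?].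
split.
  move=> /nbhs_ballP [e /= e0 eA].
  have [Re0 Ime0] : 0 < Re e /\ Im e = 0.
    by move: e0; rewrite ltcE/= => /andP[/eqP -> ->].
  exists (Re e / 2); first by rewrite divr_gt0.
  move=> w hr hi; apply: eA; rewrite -ball_normE /ball_/= distrC.
  suff h : Normc.normc (w - z) < Re e by rewrite ltcE /= Ime0 eqxx.
  apply: le_lt_trans (normc_le _) _; rewrite ReB ImB.
  by rewrite [ltRHS]splitr ltrD.
move=> [e e0 eA]; apply/nbhs_ballP; exists e%:C; first by rewrite /= ltcR.
move=> w; rewrite -ball_normE /ball_/= distrC => h.
have {}h : Normc.normc (w - z) < e by move: h; rewrite ltcE/= => /andP[].
by apply: eA; [rewrite -ReB|rewrite -ImB]; apply: le_lt_trans h;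
  [exact: Re_le_normc|exact: Im_le_normc].
Qed.

Section continuity.
Context {X : topologicalType}.

Lemma continuous_Complex (f g : X -> R) (x : X) :
  {for x, continuous f} -> {for x, continuous g} ->
  {for x, continuous (fun x => f x +i* g x)}.
Proof.
move=> cf cg A /nbhs_box [e e0 eA].
have hf : \forall y \near x, `|f y - f x| < e.
  exact: (@cvgr_distC_lt _ _ _ _ _ f (f x) cf).
have hg : \forall y \near x, `|g y - g x| < e.
  exact: (@cvgr_distC_lt _ _ _ _ _ g (g x) cg).
by near=> y; apply: eA => /=; near: y.
Unshelve. all: end_near. Qed.
End continuity.

Lemma continuous_Re : continuous Re.
Proof.
move=> z; apply/(@cvgrPdistC_lt R R _ (nbhs z) _ Re) => e e0.
by apply/nbhs_box; exists e => // w + _.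
Qed.

Lemma continuous_Im : continuous Im.
Proof.
move=> z; apply/(@cvgrPdistC_lt R R _ (nbhs z) _ Im) => e e0.
by apply/nbhs_box; exists e => // w _.
Qed.

(** * Angles modulo 2 pi *)

Lemma cosDz (x : R) (n : int) : cos (x + (pi *+ 2) *~ n) = cos x.
Proof.
have h m y : cos (y + (pi *+ 2) *+ m) = cos y :> R.
  exact: (@periodicn R R _ _ (@cosD2pi R) m y).
case: n => m; first by rewrite -pmulrn h.
by rewrite NegzE mulrNz -pmulrn -[LHS](h m.+1) subrK.
Qed.

Lemma sinDz (x : R) (n : int) : sin (x + (pi *+ 2) *~ n) = sin x.
Proof.
have h m y : sin (y + (pi *+ 2) *+ m) = sin y :> R.
  exact: (@periodicn R R _ _ (@sinD2pi R) m y).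
case: n => m; first by rewrite -pmulrn h.
by rewrite NegzE mulrNz -pmulrn -[LHS](h m.+1) subrK.
Qed.

(** Reduce [a - b] modulo 2 pi to [d] in [0, 2 pi[. Then cos d = 1, so sin (d / 2) = 0 with d / 2 in
    [0, pi[, which leaves only d = 0. *)
Lemma cos_sin_eq (a b : R) : cos a = cos b -> sin a = sin b ->
  exists n : int, a = b + (pi *+ 2) *~ n.
Proof.
move=> ca sa.
have pi0 : 0 < pi *+ 2 :> R by rewrite pmulrn_lgt0 // pi_gt0.
pose n := Num.floor ((a - b) / (pi *+ 2)).
pose d := a - b - (pi *+ 2) *~ n.
have d_ge0 : 0 <= d.
  by rewrite subr_ge0 -mulrzr mulrC -ler_pdivlMr// /n floor_le.
have d_lt : d < pi *+ 2.
    have : (a - b) / (pi *+ 2) < (n + 1)%:~R by rewrite -floor_lt_int ltrDl.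
    rewrite ltr_pdivrMr// intrD mulrDl mul1r mulrC mulrzr /d => h.
    by rewrite ltrBlDl.
have cd : cos d = 1.
  by rewrite /d -mulrNz cosDz cosB ca sa -!expr2 cos2Dsin2.
exists n; apply/eqP; rewrite -subr_eq0 opprD addrA; change (d == 0).
have : sin (d / 2) ^+ 2 = 0.
  have := cosD (d / 2) (d / 2).
  by rewrite -splitr cd -!expr2 cos2sin2; lra.
move/eqP; rewrite sqrf_eq0 => /eqP sd.
have [//|dn0] := eqVneq d 0.
have : 0 < sin (d / 2); last by rewrite sd ltxx.
have d0 : 0 < d by rewrite lt_def dn0.
by apply: sin_gt0_pi; apply/andP; split; lra.
Qed.

End Plane.

(** * Lifting angles *)

Lemma continuous_pair {X Y Z : topologicalType} (f : X -> Y) (g : X -> Z) x :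
  {for x, continuous f} -> {for x, continuous g} ->
  {for x, continuous (fun x => (f x, g x))}.
Proof. by move=> cf cg; exact: (cvg_pair cf cg). Qed.

Lemma continuous_fst {X Y : topologicalType} : continuous (@fst X Y).
Proof. by move=> x; exact: cvg_fst. Qed.

Lemma continuous_snd {X Y : topologicalType} : continuous (@snd X Y).
Proof. by move=> x; exact: cvg_snd. Qed.

(** The two bilinear expressions are the cosine and the sine of the angle from the first unit vector
    to the second. When the cosine is positive, the arcsine recovers this angle, and its argument
    stays inside ]-1, 1[, where it is continuous. *)
Lemma rotation_asin {R : realType} (c1 s1 c2 s2 : R) :
    c1 ^+ 2 + s1 ^+ 2 = 1 -> c2 ^+ 2 + s2 ^+ 2 = 1 ->
    0 < c1 * c2 + s1 * s2 ->
  let d := asin (c1 * s2 - s1 * c2) in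
  [/\ -1 < c1 * s2 - s1 * c2 < 1, c2 = c1 * cos d - s1 * sin d &
      s2 = s1 * cos d + c1 * sin d].
Proof.
move=> u1 u2; set C := _ + _; set S := _ - _ => C0 d.
have CS : C ^+ 2 + S ^+ 2 = 1.
  transitivity ((c1 ^+ 2 + s1 ^+ 2) * (c2 ^+ 2 + s2 ^+ 2)).
    by rewrite /C /S; ring.
  by rewrite u1 u2 mulr1.
have S1 : -1 < S < 1.
  by rewrite -ltr_norml -(@expr_lt1 _ 2)// real_normK ?num_real// -CS
    ltrDr exprn_gt0.
have sS : sin d = S.
  by apply: asinK; rewrite in_itv /=; case/andP: S1 => /ltW -> /ltW ->.
have cS : cos d = C.
  rewrite cos_asin; last by case/andP: S1 => /ltW -> /ltW ->.
  by rewrite -CS addrK sqrtr_sqr ger0_norm// ltW.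
rewrite sS cS /C /S; split => //.
- transitivity ((c1 ^+ 2 + s1 ^+ 2) * c2); first by rewrite u1 mul1r.
  ring.
- transitivity ((c1 ^+ 2 + s1 ^+ 2) * s2); first by rewrite u1 mul1r.
  ring.
Qed.

Section AngleLifting.
Context {R : realType} {V : topologicalType}.

(** [theta p] is the total rotation of the circle-valued map between times 0 and 1 along p.
    Compactness gives a subdivision of [0, 1], uniform over [K], whose successive values make acute
    angles; [theta] is the sum of the corresponding arcsines. *)
Lemma angle_lifting (K : set V) (c s : V * R -> R) :
    compact K -> continuous c -> continuous s ->
    (forall q, c q ^+ 2 + s q ^+ 2 = 1) ->
  exists theta : V -> R, forall p, K p ->
    [/\ {for p, continuous theta},
        c (p, 1) = c (p, 0) * cos (theta p) - s (p, 0) * sin (theta p) &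
        s (p, 1) = s (p, 0) * cos (theta p) + c (p, 0) * sin (theta p)].
Proof.
move=> cK cc cs cs1.
pose C p a b := c (p, a) * c (p, b) + s (p, a) * s (p, b).
pose S p a b := c (p, a) * s (p, b) - s (p, a) * c (p, b).
have cont (f : V * R -> R) (b : R) p : continuous f ->
    {for p, continuous (fun p => f (p, b))}.
  move=> cf; apply: (continuous_comp (f := fun p => (p, b)) (g := f)).
    by apply: continuous_pair => //; exact: cvg_cst.
  exact: cf.
have [N CN] : exists N : nat, forall p a b, K p -> 0 <= a <= 1 ->
    `|b - a| <= N.+1%:R^-1 -> 0 < C p a b.
  have cK01 : compact (K `*` (`[0, 1]%classic : set R) : set (V * R)%type).
    by apply: compact_setX => //; exact: segment_compact.
  pose P (N : nat) (q : V * R) :=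
    forall b, `|b - q.2| <= N.+1%:R^-1 -> 0 < C q.1 q.2 b.
  (* It is enough to bound the step locally: near each point of the compact product, for all large
     [N]. *)
  have [|N _ NP] := (compact_near_coveringP _).1 cK01 nat \oo P _.
    move=> q Kq; pose H (t : (V * R) * R) := C t.1.1 t.1.2 t.2.
    have cH : {for (q, q.2), continuous H}.
      have cl (f : V * R -> R) : continuous f ->
          {for (q, q.2), continuous (fun t => f (t.1.1, t.1.2))}.
        move=> cf; apply: (continuous_comp (f := fun t => (t.1.1, t.1.2)) (g := f)).
          apply: continuous_pair; apply: (continuous_comp (f := fst));
            by [exact: continuous_fst|exact: continuous_snd].
        exact: cf.
      have cr (f : V * R -> R) : continuous f ->
          {for (q, q.2), continuous (fun t => f (t.1.1, t.2))}.
        move=> cf; apply: (continuous_comp (f := fun t => (t.1.1, t.2)) (g := f)).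
          apply: continuous_pair; last exact: continuous_snd.
          by apply: (continuous_comp (f := fst) (g := fst));
            exact: continuous_fst.
        exact: cf.
      by apply: cvgD; apply: cvgM; (exact: cl || exact: cr).
    have H0 : 0 < H (q, q.2) by rewrite /H /C /= -!expr2 -surjective_pairing cs1.
    have [[A B] /= [nA nB] AB] := cvgr_gt (H (q, q.2)) cH 0 H0.
    have /nbhs_ballP[e /= e0 eB] := nB.
    (* One half bounds the move of the base time from [q.2] to [q'.2], the other the step from
       [q'.2] to [b]. *)
    have e2 : 0 < e / 2 by rewrite divr_gt0.
    exists (A `&` [set q' | `|q.2 - q'.2| < e / 2],
            [set n | n.+1%:R^-1 < e / 2]) => /=.
      split; last exact: (near_infty_natSinv_lt (PosNum e2)).
      apply: filterI => //.
      exact: (cvgr_dist_lt _ q.2 (@continuous_snd _ _ q) _ e2).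
    move=> [q' n] /= [[Aq' q'e] ne] b bq'.
    apply: (AB (q', b)); split => //=; apply: eB; rewrite -ball_normE /ball_/=.
    rewrite -(subrKA q'.2) [e]splitr (le_lt_trans (ler_normD _ _))// ltrD//.
    by rewrite distrC (le_lt_trans bq').
  exists N => p a b Kp a01 ab; apply: (NP N _ (p, a)) => //=.
(* Induction on the number of subdivision steps: this [theta] is the rotation from time 0 to time j
   / (N + 1). *)
have step j : (j <= N.+1)%N -> exists theta : V -> R, forall p, K p ->
    [/\ {for p, continuous theta},
        c (p, j%:R / N.+1%:R) =
          c (p, 0) * cos (theta p) - s (p, 0) * sin (theta p) &
        s (p, j%:R / N.+1%:R) =
          s (p, 0) * cos (theta p) + c (p, 0) * sin (theta p)].
  elim: j => [_|j IH jN].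
    exists (fun=> 0) => p _.
    by rewrite mul0r cos0 sin0 !mulr1 !mulr0 subr0 addr0; split => //;
      exact: cvg_cst.
  have [theta th] := IH (ltnW jN).
  set a := _ / _ in th; set b := _ / _.
  exists (fun p => theta p + asin (S p a b)) => p Kp.
  have [ct ca sa] := th p Kp.
  have Cp : 0 < C p a b.
    apply: CN => //.
      rewrite divr_ge0//= ler_pdivrMr ?ltr0n// mul1r ler_nat ltnW//.
    by rewrite /a /b -mulrBl -natrB// subSnn mul1r ger0_norm.
  have [] := rotation_asin _ _ _ _ (cs1 (p, a)) (cs1 (p, b)) Cp.
  rewrite -/(S p a b) => S1 cb sb.
  split.
  - apply: cvgD => //.
    apply: (continuous_comp (f := fun p => S p a b) (g := asin)).
      by apply: cvgB; apply: cvgM; exact: cont.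
    exact: continuous_asin.
  - by rewrite cosD sinD [LHS]cb ca sa; ring.
  - by rewrite cosD sinD [LHS]sb ca sa; ring.
have [|theta th] := step N.+1; first by [].
exists theta => p Kp; rewrite divff ?pnatr_eq0// in th; exact: th.
Qed.
End AngleLifting.

(** * The complex exponential *)

Section ComplexExp.
Local Open Scope complex_scope.
Context {R : realType}.
Implicit Types z w : R[i].
Local Notation Re := (@complex.Re R).
Local Notation Im := (@complex.Im R).
Local Notation normc := (@Normc.normc R).

Lemma sqr_normc z : normc z ^+ 2 = Re z ^+ 2 + Im z ^+ 2.
Proof. by case: z => a b /=; rewrite sqr_sqrtr// addr_ge0 ?sqr_ge0. Qed.

Lemma normc_gt0 z : z != 0 -> 0 < normc z.
Proof.
move=> z0; rewrite lt_def; apply/andP; split.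
  by apply: contra z0 => /eqP /Normc.eq0_normc ->.
by case: z {z0} => a b; exact: sqrtr_ge0.
Qed.

Lemma normc_unit z : z != 0 ->
  (Re z / normc z) ^+ 2 + (Im z / normc z) ^+ 2 = 1.
Proof.
move=> z0; rewrite !expr_div_n -mulrDl -sqr_normc divff// expf_neq0//.
by rewrite gt_eqF// normc_gt0.
Qed.

(** The arccosine fixes the cosine and makes the sine nonnegative, equal to the absolute value of
    the required one; the sign of [Im z] in [carg] corrects it. *)
Lemma cos_sin_carg z : z != 0 ->
  cos (carg z) = Re z / normc z /\ sin (carg z) = Im z / normc z.
Proof.
move=> z0; have u := normc_unit z z0; have n0 := normc_gt0 z z0.
set c := Re z / _ in u *; set s := Im z / _ in u *.
have c1 : -1 <= c <= 1.
  rewrite -ler_norml -(@expr_le1 _ 2)// real_normK ?num_real// -u.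
  by rewrite lerDl sqr_ge0.
have sE : Num.sqrt (1 - c ^+ 2) = `|s| by rewrite -u addrC addKr sqrtr_sqr.
have s_ge0 : (0 <= Im z) = (0 <= s) by rewrite /s pmulr_lge0 ?invr_gt0.
rewrite /carg -/c s_ge0; case: ifPn => s0.
  rewrite sin_acos// sE ger0_norm//; split => //.
  by apply: acosK; rewrite in_itv.
rewrite cosN sinN sin_acos// sE ltr0_norm ?ltNge// opprK; split => //.
by apply: acosK; rewrite in_itv.
Qed.

Lemma unit_angle (c s : R) : c ^+ 2 + s ^+ 2 = 1 ->
  exists t, c = cos t /\ s = sin t.
Proof.
move=> cs1; pose z := c +i* s.
have nz : normc z = 1 by rewrite /= cs1 sqrtr1.
have [|cz sz] := cos_sin_carg z.
  by apply/eqP => z0; move: nz; rewrite z0 Normc.normc0 => /esym/eqP; rewrite oner_eq0.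
by exists (carg z); rewrite cz sz nz !divr1.
Qed.

Definition cexp w : R[i] :=
  (expR (Re w) * cos (Im w)) +i* (expR (Re w) * sin (Im w)).

Lemma normc_cexp w : normc (cexp w) = expR (Re w).
Proof.
by rewrite /= !exprMn -mulrDr cos2Dsin2 mulr1 sqrtr_sqr ger0_norm// expR_ge0.
Qed.

Lemma cexp_neq0 w : cexp w != 0.
Proof.
apply/eqP => w0; have := expR_gt0 (Re w).
by rewrite -normc_cexp w0 Normc.normc0 ltxx.
Qed.

Lemma clogK z : z != 0 -> cexp (clog z) = z.
Proof.
move=> z0; have [cz sz] := cos_sin_carg z z0; have n0 := normc_gt0 z z0.
rewrite /cexp /= lnK ?posrE// cz sz ![normc z * _]mulrC !divfK ?gt_eqF//.
by case: (z).
Qed.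

Lemma cexpK w : exists n : int, clog (cexp w) = w + (0 +i* ((pi *+ 2) *~ n)).
Proof.
have [cz sz] := cos_sin_carg _ (cexp_neq0 w).
rewrite normc_cexp in cz sz.
have e0 : expR (Re w) != 0 by rewrite gt_eqF ?expR_gt0.
have [||n hn] := @cos_sin_eq R (carg (cexp w)) (Im w).
- by rewrite cz /= mulrAC divff// mul1r.
- by rewrite sz /= mulrAC divff// mul1r.
exists n; rewrite /clog normc_cexp expRK hn.
by case: w {hn cz sz e0} => a b; apply/eqP; rewrite eq_complex /= addr0 !eqxx.
Qed.

Lemma expRMz (x : R) (n : int) : expR (x *~ n) = expR x ^ n.
Proof.
case: n => n; first by rewrite -pmulrn -mulr_natl expRM_natl.
by rewrite NegzE mulrNz -pmulrn expRN -mulr_natl expRM_natl -exprnN.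
Qed.

(** The translations by the period lattice of the torus of period [ln T] become the dilations by
    powers of T: these are the deck transformations of [phi]. *)
Lemma cexpD (T : R) w (m n : int) : 0 < T ->
  cexp (w + ((ln T *~ m) +i* ((pi *+ 2) *~ n))) = (T ^ m)%:C * cexp w.
Proof.
move=> T0; case: w => a b.
rewrite /cexp /= cosDz sinDz expRD expRMz lnK ?posrE//.
by apply/eqP; rewrite eq_complex /=; apply/andP; split; apply/eqP; ring.
Qed.

Lemma continuous_cexp : continuous cexp.
Proof.
move=> w; have FF : Filter (nbhs w) by exact: nbhs_filter.
have cr := @continuous_Re R w; have ci := @continuous_Im R w.
have ce : {for w, continuous (fun w => expR (Re w))}.
  by apply: (continuous_comp (f := Re) (g := expR)) => //; exact: continuous_expR.
have cc : {for w, continuous (fun w => cos (Im w))}.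
  by apply: (continuous_comp (f := Im) (g := cos)) => //; exact: continuous_cos.
have cs : {for w, continuous (fun w => sin (Im w))}.
  by apply: (continuous_comp (f := Im) (g := sin)) => //; exact: continuous_sin.
apply: (continuous_Complex (fun w => expR (Re w) * cos (Im w))
  (fun w => expR (Re w) * sin (Im w))); exact: cvgM.
Qed.

Lemma continuous_normc : continuous normc.
Proof.
move=> z; have FF : Filter (nbhs z) by exact: nbhs_filter.
have -> : normc = fun z => Num.sqrt (Re z ^+ 2 + Im z ^+ 2).
  by apply/funext => -[a b].
apply: (continuous_comp (f := fun z => Re z ^+ 2 + Im z ^+ 2) (g := Num.sqrt)).
  have cr := @continuous_Re R z; have ci := @continuous_Im R z.
  by apply: cvgD; apply: cvgM.
exact: sqrt_continuous.
Qed.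

(** [clog] jumps across the negative real axis. A continuous branch near z adds to [carg z] the
    arcsine of the small rotation from z to u. *)
Lemma local_clog z : z != 0 -> exists l : R[i] -> R[i],
  [/\ {for z, continuous l}, l z = clog z &
      \forall u \near z, u != 0 /\ cexp (l u) = u].
Proof.
move=> z0; have n0 := normc_gt0 z z0.
have cn := continuous_normc z.
have cV : {for z, continuous (fun u => (normc u)^-1)}.
  exact: (@cvgV _ _ _ _ normc (normc z) (lt0r_neq0 n0) cn).
have cr : {for z, continuous (fun u => Re u / normc u)}.
  exact: (cvgM (@continuous_Re R z) cV).
have ci : {for z, continuous (fun u => Im u / normc u)}.
  exact: (cvgM (@continuous_Im R z) cV).
pose C u := Re z / normc z * (Re u / normc u) + Im z / normc z * (Im u / normc u).
pose S u := Re z / normc z * (Im u / normc u) - Im z / normc z * (Re u / normc u).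
have Cz : C z = 1 by rewrite /C -!expr2 normc_unit.
have Sz : S z = 0 by rewrite /S; ring.
have cC : {for z, continuous C}.
  exact: (cvgD (cvgM (cvg_cst _) cr) (cvgM (cvg_cst _) ci)).
have cS : {for z, continuous S}.
  exact: (cvgB (cvgM (cvg_cst _) ci) (cvgM (cvg_cst _) cr)).
exists (fun u => ln (normc u) +i* (carg z + asin (S u))); split.
- apply: (continuous_Complex (fun u => ln (normc u))
    (fun u => carg z + asin (S u))).
    apply: (continuous_comp (f := normc) (g := @ln R)) => //.
    exact: continuous_ln.
  suff cA : {for z, continuous (fun u => asin (S u))}.
    exact: (cvgD (cvg_cst _) cA).
  apply: (continuous_comp (f := S) (g := asin)) => //.
  by apply: continuous_asin; rewrite Sz ltr01 ltrN10.
- have p2 : 0 <= pi / 2 :> R by rewrite divr_ge0 ?pi_ge0.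
  have asin0 : asin 0 = 0 :> R.
    by rewrite -[in LHS](@sin0 R) sinK// in_itv /= oppr_le0 p2.
  by rewrite Sz asin0 addr0.
- have nC : \forall u \near z, 0 < C u by apply: (cvgr_gt (C z) cC); rewrite Cz.
  have nn : \forall u \near z, 0 < normc u by apply: (cvgr_gt (normc z) cn).
  near=> u.
  have u0 : u != 0.
    apply/eqP => u0; have : 0 < normc u by near: u.
    by rewrite u0 Normc.normc0 ltxx.
  split => //.
  have Cu : 0 < C u by near: u.
  have nu := normc_gt0 u u0.
  have [_ cu su] := rotation_asin _ _ _ _ (normc_unit z z0) (normc_unit u u0) Cu.
  have [cz sz] := cos_sin_carg z z0.
  rewrite /cexp /= lnK ?posrE// cosD sinD cz sz -/(S u).
  rewrite -/(S u) in cu su; rewrite -cu -su.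
  rewrite ![normc u * _]mulrC !divfK ?gt_eqF//; by case: (u).
Unshelve. all: end_near. Qed.
End ComplexExp.

(** * Lifting maps to the torus *)

Section TorusLifting.
Local Open Scope complex_scope.
Context {R : realType}.
Implicit Types (z w : R[i]) (P T : R).
Local Notation Re := (@complex.Re R).
Local Notation Im := (@complex.Im R).

Lemma torus_projP P z w : torus_proj P z = torus_proj P w <->
  exists m n : int, z = w + ((P *~ m) +i* ((pi *+ 2) *~ n)).
Proof.
split; last by move=> h; apply/eqmodP/asboolP.
by move=> /eqmodP/asboolP.
Qed.

Lemma torus_proj_surj P (d : torus P) : exists w, d = torus_proj P w.
Proof. by exists (repr d); rewrite /torus_proj reprK. Qed.

Lemma continuous_torus_proj P : continuous (@torus_proj R P).
Proof. exact: pi_continuous. Qed.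

Lemma phi_cexp P w : phi P (cexp w) = torus_proj P w.
Proof.
have [n nE] := cexpK w; apply/torus_projP; exists 0, n.
by rewrite mulr0z.
Qed.

Lemma phi_eq T z w : 0 < T -> z != 0 -> w != 0 ->
  phi (ln T) z = phi (ln T) w <-> exists m : int, z = (T ^ m)%:C * w.
Proof.
move=> T0 z0 w0; split.
  move=> /torus_projP [m [n]] /(congr1 cexp).
  by rewrite cexpD// !clogK// => ->; exists m.
move=> [m ->]; rewrite -[in LHS](clogK w w0) -(cexpD T _ m 0)// phi_cexp.
by apply/torus_projP; exists m, 0.
Qed.

(** The jumps of [clog] are periods of the torus, so near z it may be replaced by a continuous
    branch. *)
Lemma continuous_phi P z : z != 0 -> {for z, continuous (@phi R P)}.
Proof.
move=> z0; have [l [cl lz lE]] := local_clog z z0.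
have cpl : {for z, continuous (torus_proj P \o l)}.
  by apply: continuous_comp => //; exact: continuous_torus_proj.
move=> A; rewrite /phi -lz => /cpl hA; apply: filterS2 lE hA => u [_ lu] Au.
by rewrite /= -lu -/(phi P _) phi_cexp.
Qed.

Lemma continuous_torus_fun P (f : R[i] -> R) : continuous f ->
    (forall z w, torus_proj P z = torus_proj P w -> f z = f w) ->
  exists2 g : torus P -> R, continuous g & forall z, g (torus_proj P z) = f z.
Proof.
move=> cf fE; exists (f \o repr).
  apply: repr_comp_continuous; first exact: cf.
  by move=> a b /eqP ab; apply/eqP; exact: fE.
by move=> z; apply: fE; rewrite /torus_proj reprK.
Qed.

Lemma torus_angle_fun P (t : R -> R) (p : R[i] -> R) :
    continuous t -> continuous p ->
    (forall x n, t (x + (pi *+ 2) *~ n) = t x) ->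
    (forall z w, torus_proj P z = torus_proj P w ->
      exists n : int, p z = p w + (pi *+ 2) *~ n) ->
  exists2 g : torus P -> R, continuous g & forall z, g (torus_proj P z) = t (p z).
Proof.
move=> ct cp tE pE; apply: continuous_torus_fun.
  by move=> z; apply: (continuous_comp (f := p) (g := t)); [exact: cp|exact: ct].
by move=> z w /pE [n ->].
Qed.

(** These functions embed the torus in a product of two circles; the rescaling by 2 pi / P turns the
    period P into a full turn. *)
Lemma torus_coords P : P != 0 ->
  exists c1 s1 c2 s2 : torus P -> R,
  [/\ continuous c1, continuous s1, continuous c2, continuous s2 &
   forall z, [/\ c1 (torus_proj P z) = cos (Re z * (pi *+ 2) / P),
                s1 (torus_proj P z) = sin (Re z * (pi *+ 2) / P),
                c2 (torus_proj P z) = cos (Im z) &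
                s2 (torus_proj P z) = sin (Im z)]].
Proof.
move=> P0; pose p1 z : R := Re z * (pi *+ 2) / P.
have cp1 : continuous p1.
  move=> z; have FF : Filter (nbhs z) by exact: nbhs_filter.
  exact: (cvgM (cvgM (@continuous_Re R z) (cvg_cst _)) (cvg_cst _)).
have p1E z w : torus_proj P z = torus_proj P w ->
    exists n : int, p1 z = p1 w + (pi *+ 2) *~ n.
  move=> /torus_projP [m [n ->]]; exists m; case: w => a b.
  by rewrite /p1 /= -(mulrzr P) -(mulrzr (pi *+ 2)); field.
have ImE z w : torus_proj P z = torus_proj P w ->
    exists n : int, Im z = Im w + (pi *+ 2) *~ n.
  by move=> /torus_projP [m [n ->]]; exists n; case: w.
have [c1 ? c1E] := torus_angle_fun P cos p1 (@continuous_cos R) cp1 (@cosDz R) p1E.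
have [s1 ? s1E] := torus_angle_fun P sin p1 (@continuous_sin R) cp1 (@sinDz R) p1E.
have [c2 ? c2E] :=
  torus_angle_fun P cos _ (@continuous_cos R) (@continuous_Im R) (@cosDz R) ImE.
have [s2 ? s2E] :=
  torus_angle_fun P sin _ (@continuous_sin R) (@continuous_Im R) (@sinDz R) ImE.
by exists c1, s1, c2, s2; split => // z; split.
Qed.

(* The contraction lets lifts start from a single value; the retraction makes
   maps that are only continuous within K, and their lifts, continuous on V. *)
Definition liftable (V : topologicalType) (K : set V) : Prop :=
  compact K /\ exists (r : V -> V) (h : V * R -> V) (p0 : V),
  [/\ continuous r, forall p, K (r p), forall p, K p -> r p = p,
      continuous h & forall p, h (p, 1) = p /\ h (p, 0) = p0].

(** The angle at p is an angle at the centre [p0] of the contraction plus the rotation accumulated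
    from [p0] to p. Precomposing with the retraction gives continuity off [K] as well. *)
Lemma circle_lift (V : topologicalType) (K : set V) (c s : V -> R) :
    liftable V K -> continuous c -> continuous s ->
    (forall p, c p ^+ 2 + s p ^+ 2 = 1) ->
  exists2 theta : V -> R, continuous theta &
    forall p, K p -> c p = cos (theta p) /\ s p = sin (theta p).
Proof.
move=> [cK [r [h [p0 [cr Kr rK ch hE]]]]] cc cs cs1.
have [||||theta th] := angle_lifting K (c \o h) (s \o h).
- exact: cK.
- by move=> q; exact: (continuous_comp (ch q) (cc (h q))).
- by move=> q; exact: (continuous_comp (ch q) (cs (h q))).
- by move=> q; exact: cs1.
have [t0 [ct st]] := unit_angle _ _ (cs1 p0).
exists (fun p => t0 + theta (r p)).
  move=> p; suff ctr : {for p, continuous (theta \o r)}.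
    exact: (cvgD (cvg_cst _) ctr).
  have [cth _ _] := th _ (Kr p); exact: (continuous_comp (cr p) cth).
move=> p Kp; have [_] := th p Kp; rewrite /= !(hE p).1 !(hE p).2 rK// ct st.
by rewrite cosD sinD => -> ->; split=> //; rewrite addrC.
Qed.

Lemma within_continuous_retract (V X : topologicalType) (K : set V) (r : V -> V)
    (f : V -> X) : continuous r -> (forall p, K (r p)) ->
  {within K, continuous f} -> continuous (f \o r).
Proof.
move=> cr Kr /subspace_continuousP cf p A /(cf _ (Kr p)) /(cr p).
by apply: (@filterS _ _ (nbhs_filter p)) => q /(_ (Kr q)).
Qed.

(** Lift the two circle coordinates separately and scale the first angle back by P / (2 pi). Points
    of the plane with equal circle coordinates differ by a period, so the lift projects to [f] on
    [K]. *)
Lemma torus_lift P (V : topologicalType) (K : set V) (f : V -> torus P) :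
    P != 0 -> liftable V K -> {within K, continuous f} ->
  exists x y : V -> R, [/\ continuous x, continuous y &
    forall p, K p -> f p = torus_proj P (x p +i* y p)].
Proof.
move=> P0 lK cf; have [_ [r [h [p0 [cr Kr rK _ _]]]]] := lK.
have cfr := within_continuous_retract _ _ _ _ _ cr Kr cf.
have [c1 [s1 [c2 [s2 [cc1 cs1 cc2 cs2 E]]]]] := torus_coords P P0.
have comp (g : torus P -> R) : continuous g -> continuous (g \o (f \o r)).
  by move=> cg p; exact: (continuous_comp (cfr p) (cg (f (r p)))).
have [||||t1 ct1 t1E] := circle_lift V K (c1 \o (f \o r)) (s1 \o (f \o r)).
- exact: lK.
- exact: comp.
- exact: comp.
- move=> p; have [w /= ->] := torus_proj_surj _ (f (r p)).
  by have [-> -> _ _] := E w; rewrite cos2Dsin2.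
have [||||t2 ct2 t2E] := circle_lift V K (c2 \o (f \o r)) (s2 \o (f \o r)).
- exact: lK.
- exact: comp.
- exact: comp.
- move=> p; have [w /= ->] := torus_proj_surj _ (f (r p)).
  by have [_ _ -> ->] := E w; rewrite cos2Dsin2.
have pi0 : pi *+ 2 != 0 :> R by rewrite mulrn_eq0 /= gt_eqF// pi_gt0.
exists (fun p => t1 p * (P / (pi *+ 2))), t2; split => //.
  move=> p; have FF : Filter (nbhs p) by exact: nbhs_filter.
  exact: (cvgM (ct1 p) (cvg_cst _)).
move=> p Kp; have [] := t1E p Kp; have [] := t2E p Kp; rewrite /= rK//.
have [w ->] := torus_proj_surj _ (f p); have [-> -> -> ->] := E w.
move=> c2E s2E c1E s1E.
have [n2 n2E] := cos_sin_eq _ _ c2E s2E.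
have [n1 n1E] := cos_sin_eq _ _ c1E s1E.
apply/torus_projP; exists n1, n2; case: w n1E n2E {c1E s1E c2E s2E} => a b /= aE ->.
congr (_ +i* _); move: pi0 aE; move: (pi *+ 2) => q q0 aE.
have -> : a = a * q / P * (P / q) by field; apply/andP.
by rewrite aE -(mulrzr P) -(mulrzr q); field.
Qed.

End TorusLifting.

(** * Singular chains *)

Section Simplices.
Context {R : realType}.

Lemma continuous_addfun {X : topologicalType} (f g : X -> R) :
  continuous f -> continuous g -> continuous (fun x => f x + g x).
Proof. by move=> cf cg x; apply: cvgD; [exact: cf|exact: cg]. Qed.

Lemma continuous_mulfun {X : topologicalType} (f g : X -> R) :
  continuous f -> continuous g -> continuous (fun x => f x * g x).
Proof. by move=> cf cg x; apply: cvgM; [exact: cf|exact: cg]. Qed.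

Lemma continuous_oppfun {X : topologicalType} (f : X -> R) :
  continuous f -> continuous (fun x => - f x).
Proof. by move=> cf x; apply: cvgN; exact: cf. Qed.

Lemma continuous_maxfun {X : topologicalType} (f g : X -> R) :
  continuous f -> continuous g -> continuous (fun x => Num.max (f x) (g x)).
Proof. by move=> cf cg x; apply: continuous_max; [exact: cf|exact: cg]. Qed.

Lemma continuous_minfun {X : topologicalType} (f g : X -> R) :
  continuous f -> continuous g -> continuous (fun x => Num.min (f x) (g x)).
Proof. by move=> cf cg x; apply: continuous_min; [exact: cf|exact: cg]. Qed.

Lemma continuous_compfun {X Y Z : topologicalType} (f : X -> Y) (g : Y -> Z) :
  continuous f -> continuous g -> continuous (fun x => g (f x)).
Proof.
by move=> cf cg x; apply: (continuous_comp (f := f) (g := g)); [exact: cf|exact: cg].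
Qed.

Lemma continuous_pairfun {X Y Z : topologicalType} (f : X -> Y) (g : X -> Z) :
  continuous f -> continuous g -> continuous (fun x => (f x, g x)).
Proof. by move=> cf cg x; apply: continuous_pair; [exact: cf|exact: cg]. Qed.

Lemma continuous_cst_fun {X Y : topologicalType} (y : Y) :
  continuous (fun _ : X => y).
Proof. by move=> x; exact: cst_continuous. Qed.

Lemma continuous_id_fun {X : topologicalType} : continuous (fun x : X => x).
Proof. by move=> x A. Qed.

Lemma liftable_simplex1 : @liftable R R (@simplex1 R).
Proof.
split; first exact: segment_compact.
exists (fun t => Num.max 0 (Num.min t 1)), (fun q => q.2 * q.1), 0; split.
- apply: continuous_maxfun; first exact: continuous_cst_fun.
  by apply: continuous_minfun; [exact: continuous_id_fun|exact: continuous_cst_fun].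
- move=> t; rewrite /simplex1 /= in_itv /= le_max lexx /=.
  by rewrite ge_max ler01 ge_min lexx orbT.
- move=> t; rewrite /simplex1 /= in_itv /= => /andP[t0 t1].
  by rewrite min_l// max_r.
- by apply: continuous_mulfun; [exact: continuous_snd|exact: continuous_fst].
- by move=> p /=; rewrite mul1r mul0r.
Qed.

(** The retraction [r] cuts negative coordinates to 0 and then divides by their sum when it exceeds
    1. Compactness follows because [r] maps the unit square onto the simplex. The contraction is
    scaling towards the origin. *)
Lemma liftable_simplex2 : @liftable R (R * R)%type (@simplex2 R).
Proof.
pose d (q : R * R) : R := Num.max 1 (Num.max q.1 0 + Num.max q.2 0).
pose r (q : R * R) : (R * R)%type := (Num.max q.1 0 / d q, Num.max q.2 0 / d q).
have d0 q : 0 < d q by rewrite lt_max ltr01.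
have c1 : continuous (fun q : R * R => Num.max q.1 0).
  exact: (continuous_maxfun _ _ continuous_fst (continuous_cst_fun 0)).
have c2 : continuous (fun q : R * R => Num.max q.2 0).
  exact: (continuous_maxfun _ _ continuous_snd (continuous_cst_fun 0)).
have cd : continuous (fun q => (d q)^-1).
  have cd : continuous d.
    have h : continuous (fun q : R * R => 1 : R) by exact: continuous_cst_fun.
    by refine (continuous_maxfun _ _ h (continuous_addfun _ _ c1 c2)).
  move=> q; have FF : Filter (nbhs q) by exact: nbhs_filter.
  exact: (@cvgV _ _ _ _ d (d q) (lt0r_neq0 (d0 q)) (cd q)).
have cr : continuous r.
  exact: (continuous_pairfun _ _ (continuous_mulfun _ _ c1 cd)
    (continuous_mulfun _ _ c2 cd)).
have Kr q : simplex2 (r q).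
  split; rewrite /r /=.
  - by apply: divr_ge0; [rewrite le_max lexx orbT|exact: ltW].
  - by apply: divr_ge0; [rewrite le_max lexx orbT|exact: ltW].
  - by rewrite -mulrDl ler_pdivrMr// mul1r le_max lexx orbT.
have rK q : simplex2 q -> r q = q.
  case: q => a b [/= a0 b0 ab]; rewrite /r /d /=.
  by rewrite !(max_l a0) !(max_l b0) max_l// !divr1.
split.
  have -> : simplex2 = r @` (`[0, 1]%classic `*` `[0, 1]%classic).
    apply/seteqP; split => [q Kq|_ [q _ <-]]; last exact: Kr.
    exists q; last exact: rK.
    case: Kq => a0 b0 ab; split => /=; rewrite in_itv /= ?a0 ?b0 /=; lra.
  apply: continuous_compact; first exact: continuous_subspaceT.
  by apply: compact_setX; exact: segment_compact.
exists r, (fun q => (q.2 * q.1.1, q.2 * q.1.2)), (0, 0); split => //.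
- exact: (continuous_pairfun _ _
    (continuous_mulfun _ _ continuous_snd
      (continuous_compfun _ _ continuous_fst continuous_fst))
    (continuous_mulfun _ _ continuous_snd
      (continuous_compfun _ _ continuous_fst continuous_snd))).
- by move=> [a b] /=; rewrite !mul1r !mul0r.
Qed.

End Simplices.

(** * Chains modulo boundaries, and functionals on chains *)

Section Chains.
Context {R : realType} {X : topologicalType}.
Implicit Types (c d : @chain1 R X).

Lemma chainD c d s : (c + d) s = c s + d s. Proof. by []. Qed.
Lemma chainN c s : (- c) s = - c s. Proof. by []. Qed.
Lemma chain0 s : (0 : @chain1 R X) s = 0. Proof. by []. Qed.
Lemma chainMn c n s : (c *+ n) s = c s *+ n.
Proof. by elim: n => [|n IH]; rewrite ?mulr0n// !mulrS chainD IH. Qed.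
Lemma chainMz c n s : (c *~ n) s = c s * n.
Proof.
rewrite -mulrzz; case: n => n; first by rewrite -!pmulrn chainMn.
by rewrite NegzE !mulrNz chainN -!pmulrn chainMn.
Qed.

Definition chainE := (chainD, chainN, chain0, chainMz).

Lemma eq_gen (s t : R -> X) : (forall u, simplex1 u -> s u = t u) ->
  gen s = gen t.
Proof.
move=> st; apply/funext => u; rewrite /gen; congr ((nat_of_bool _)%:Z).
apply/asboolP/asboolP => h v v1; first by rewrite -st// h.
by rewrite st// h.
Qed.

(** [homologous c d] is convertible to [boundary1 (c - d)], so homologies can be combined by the
    group operations on boundaries. *)
Definition boundary1 c : Prop :=
  exists (N : nat) (m : 'I_N -> int) (s : 'I_N -> R * R -> X),
    (forall i, singular2 (s i)) /\ c = \sum_(i < N) bd2 (s i) *~ m i.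

Lemma boundary1_bd2 s : singular2 s -> boundary1 (bd2 s).
Proof.
move=> ss; exists 1%N, (fun=> 1), (fun=> s); split => //.
by rewrite big_ord1.
Qed.

Lemma boundary1N c : boundary1 c -> boundary1 (- c).
Proof.
move=> [N [m [s [ss ->]]]]; exists N, (fun i => - m i), s; split => //.
by rewrite -sumrN; apply: eq_bigr => i _; rewrite mulrNz.
Qed.

Lemma boundary1D c d : boundary1 c -> boundary1 d -> boundary1 (c + d).
Proof.
move=> [N [m [s [ss ->]]]] [N' [m' [s' [ss' ->]]]].
exists (N + N')%N,
  (fun i => match fintype.split i with inl j => m j | inr j => m' j end),
  (fun i => match fintype.split i with inl j => s j | inr j => s' j end); split.
  by move=> i; case: (fintype.split i).
rewrite big_split_ord /=; congr (_ + _); apply: eq_bigr => i _.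
  by rewrite (unsplitK (inl i)).
by rewrite (unsplitK (inr i)).
Qed.

Lemma boundary1B c d : boundary1 c -> boundary1 d -> boundary1 (c - d).
Proof. by move=> ? /boundary1N; exact: boundary1D. Qed.

(** A map from the integers to chains that is additive modulo boundaries is determined modulo
    boundaries by its value at 1. *)
Lemma boundary1_linear (f : int -> @chain1 R X) n :
  (forall m n, boundary1 (f (m + n) - f m - f n)) -> boundary1 (f n - f 1 *~ n).
Proof.
move=> fD.
have f0 : boundary1 (f 0).
  rewrite (_ : f 0 = - (f (0 + 0) - f 0 - f 0)); first exact: boundary1N.
  by apply/funext => s; rewrite addr0 !chainE; ring.
have fn (k : nat) : boundary1 (f k%:Z - f 1 *~ k%:Z).
  elim: k => [|k IH]; first by rewrite mulr0z subr0.
  have := boundary1D _ _ (fD k 1) IH.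
  rewrite (_ : k%:Z + 1 = k.+1%:Z); last by rewrite -addn1.
  congr boundary1; apply/funext => s.
  by rewrite !chainE (_ : k.+1%:Z = k%:Z + 1) ?mulrDr; [ring|rewrite -addn1].
case: n => // n; rewrite NegzE.
(* Negative arguments: [f (- n.+1)] and [f n.+1] add up to [f 0] modulo boundaries, and [f 0] is
   itself a boundary. *)
have := boundary1D _ _ (boundary1B _ _ f0 (fD (- n.+1%:Z) n.+1%:Z)) (boundary1N _ (fn n.+1)).
rewrite addNr; congr boundary1; apply/funext => s.
by rewrite !chainE; ring.
Qed.

(** A [chain1] may have infinite support, so the linear extension of [F] is formed over the finitely
    many simplices of [l] only; this suffices for any single homology. *)
Lemma chain_functional (F : (R -> X) -> R) (l : seq (R -> X)) :
    (forall s t, (forall u, simplex1 u -> s u = t u) -> F s = F t) ->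
  exists L : @chain1 R X -> R,
    [/\ forall c d, L (c + d) = L c + L d, forall c n, L (c *~ n) = L c *~ n
      & forall s, s \in l -> L (gen s) = F s].
Proof.
move=> Fext.
(* A canonical representative of the functions that agree on [0, 1], so that [undup] counts each
   generator once. *)
pose canon (s : R -> X) : R -> X := fun u => if u \in `[0, 1] then s u else s 0.
have canonE s u : simplex1 u -> canon s u = s u.
  by rewrite /simplex1 /canon /= => ->.
have canon_eq s t : (forall u, simplex1 u -> s u = t u) -> canon s = canon t.
  move=> st; apply/funext => u; rewrite /canon; case: ifPn => [u1|_]; apply: st => //.
  by rewrite /simplex1 /= in_itv /= lexx ler01.
pose S := undup [seq canon s | s <- l].
exists (fun c => \sum_(t <- S) F t *~ c t); split.
- move=> c d; rewrite -big_split /=; apply: eq_bigr => t _.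
  by rewrite chainD mulrzDr.
- move=> c n; rewrite mulrz_suml; apply: eq_bigr => t _.
  by rewrite chainMz mulrzA.
- move=> s ls; have Ss : canon s \in S by rewrite mem_undup map_f.
  rewrite (bigD1_seq (canon s)) ?undup_uniq//= big1_seq ?addr0.
    rewrite /gen asboolT ?mulr1z; first by apply: Fext => u /canonE.
    by move=> u /canonE.
  move=> t /andP[ts]; rewrite mem_undup => /mapP[t' _ tE].
  rewrite /gen asboolF ?mulr0z// => st; move/eqP: ts; apply.
  rewrite tE; apply: canon_eq => u u1.
  by rewrite st// tE canonE.
Qed.

End Chains.

(** * Homology of closed curves on the torus *)

Section TorusHomology.
Local Open Scope complex_scope.
Context {R : realType}.
Context (P : R).
Implicit Types (x y f g e : R -> R).

Let curve x y (t : R) : torus P := torus_proj P (x t +i* y t).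
Let seg (a b v w t : R) : torus P := torus_proj P ((a + t * v) +i* (b + t * w)).

Lemma singular2_proj (u v : R * R -> R) : continuous u -> continuous v ->
  singular2 (fun q => torus_proj P (u q +i* v q)).
Proof.
move=> cu cv; apply: continuous_subspaceT.
apply: (continuous_compfun _ _ _ (continuous_torus_proj P)).
by move=> q; exact: (continuous_Complex u v q (cu q) (cv q)).
Qed.

(** A constant 2-simplex has three equal faces, with signs +, - and +. *)
Lemma boundary1_cst (d : torus P) : @boundary1 R _ (gen (fun=> d)).
Proof.
have /boundary1_bd2 : singular2 (fun _ : R * R => d).
  by apply: continuous_subspaceT; exact: continuous_cst_fun.
by rewrite /bd2 subrr add0r.
Qed.

(* For [e 0 = e 1 = 0], a continuous extension of [e] from the bottom edge of
   the standard 2-simplex by 0 on the two other edges. *)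
Let fan e (q : R * R) : R :=
  Num.min (Num.max (e q.1) 0) (Num.max (e (q.1 + q.2)) 0) +
  Num.max (Num.min (e q.1) 0) (Num.min (e (q.1 + q.2)) 0).

Let continuous_sum : continuous (fun q : R * R => q.1 + q.2).
Proof. by refine (continuous_addfun _ _ continuous_fst continuous_snd). Qed.

Let continuous_fan e : continuous e -> continuous (fan e).
Proof.
move=> ce.
have c0 : continuous (fun q : R * R => 0 : R) by exact: continuous_cst_fun.
have c1 : continuous (fun q : R * R => e q.1).
  exact: (continuous_compfun _ _ continuous_fst ce).
have c2 : continuous (fun q : R * R => e (q.1 + q.2)).
  exact: (continuous_compfun _ _ continuous_sum ce).
by refine (continuous_addfun _ _
  (continuous_minfun _ _ (continuous_maxfun _ _ c1 c0) (continuous_maxfun _ _ c2 c0))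
  (continuous_maxfun _ _ (continuous_minfun _ _ c1 c0) (continuous_minfun _ _ c2 c0))).
Qed.

Let max_min0 (a : R) : Num.max a 0 + Num.min a 0 = a.
Proof. by case: (leP a 0) => ?; rewrite ?add0r ?addr0. Qed.

Let fan_bottom e t : fan e (t, 0) = e t.
Proof. by rewrite /fan /= addr0 minxx maxxx max_min0. Qed.

Let fan_left e t : e 0 = 0 -> fan e (0, t) = 0.
Proof.
move=> e0; rewrite /fan /= e0 maxxx minxx add0r min_l ?le_max ?lexx ?orbT//.
by rewrite max_l ?addr0// ge_min lexx orbT.
Qed.

Let fan_slope e t : e 1 = 0 -> fan e (1 - t, t) = 0.
Proof.
move=> e1; rewrite /fan /= subrK e1 maxxx minxx min_r ?le_max ?lexx ?orbT//.
by rewrite max_r ?addr0// ge_min lexx orbT.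
Qed.

(** A 2-simplex has the path as its bottom edge, the straight segment as its left edge, and a slope
    collapsed to the end point, which contributes only a constant simplex. *)
Lemma boundary1_straighten x y : continuous x -> continuous y ->
  @boundary1 R _ (gen (curve x y) -
    gen (seg (x 0) (y 0) (x 1 - x 0) (y 1 - y 0))).
Proof.
move=> cx cy.
pose dev f t := f t - (f 0 + t * (f 1 - f 0)).
(* The affine part agrees with the segment on both legs; [fan] adds the deviation of the path from
   it on the bottom edge alone. *)
pose s f (q : R * R) := f 0 + (q.1 + q.2) * (f 1 - f 0) + fan (dev f) q.
have cs f : continuous f -> continuous (s f).
  move=> cf; have cst (a : R) (V : topologicalType) : continuous (fun _ : V => a).
    exact: continuous_cst_fun.
  have cdev : continuous (dev f).
    by refine (continuous_addfun _ _ cf (continuous_oppfun _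
      (continuous_addfun _ _ (cst (f 0) R)
        (continuous_mulfun _ _ continuous_id_fun (cst (f 1 - f 0) R))))).
  by refine (continuous_addfun _ _ (continuous_addfun _ _ (cst (f 0) _)
    (continuous_mulfun _ _ continuous_sum (cst (f 1 - f 0) _)))
    (continuous_fan _ cdev)).
have d0 f : dev f 0 = 0 by rewrite /dev; ring.
have d1 f : dev f 1 = 0 by rewrite /dev; ring.
have sb f t : s f (t, 0) = f t by rewrite /s fan_bottom /dev /=; ring.
have sl f t : s f (0, t) = f 0 + t * (f 1 - f 0).
  by rewrite /s fan_left//= add0r addr0.
have ss f t : s f (1 - t, t) = f 1 by rewrite /s fan_slope//=; ring.
have := boundary1B _ _ (boundary1_bd2 _ (singular2_proj _ _ (cs _ cx) (cs _ cy)))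
  (boundary1_cst (torus_proj P (x 1 +i* y 1))).
congr boundary1; rewrite /bd2 /=.
under [X in gen X - _ + _]eq_fun do rewrite !ss.
under [X in _ - gen X + _]eq_fun do rewrite !sl.
under [X in _ - _ + gen X]eq_fun do rewrite !sb.
by apply/funext => u; rewrite !chainE; ring.
Qed.

(** The projection of an affine triangle: the bottom edge and then the slope against the left
    edge. *)
Lemma boundary1_triangle a b v w v' w' :
  @boundary1 R _ (gen (seg a b v w) + gen (seg (a + v) (b + w) v' w') -
    gen (seg a b (v + v') (w + w'))).
Proof.
pose s (c u u' : R) (q : R * R) := c + (q.1 + q.2) * u + q.2 * u'.
have cs c u u' : continuous (s c u u').
  have cst (k : R) : continuous (fun _ : R * R => k) by exact: continuous_cst_fun.
  by refine (continuous_addfun _ _ (continuous_addfun _ _ (cst c)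
    (continuous_mulfun _ _ continuous_sum (cst u)))
    (continuous_mulfun _ _ continuous_snd (cst u'))).
have := boundary1_bd2 _ (singular2_proj _ _ (cs a v v') (cs b w w')).
have ss c u u' t : s c u u' (1 - t, t) = c + u + t * u' by rewrite /s /=; ring.
have sl c u u' t : s c u u' (0, t) = c + t * (u + u') by rewrite /s /=; ring.
have sb c u u' t : s c u u' (t, 0) = c + t * u by rewrite /s /=; ring.
congr boundary1; rewrite /bd2 /=.
under [X in gen X - _ + _]eq_fun do rewrite !ss.
under [X in _ - gen X + _]eq_fun do rewrite !sl.
under [X in _ - _ + gen X]eq_fun do rewrite !sb.
by apply/funext => u; rewrite !chainE; ring.
Qed.

Lemma eq_seg a b a' b' v w :
  torus_proj P (a +i* b) = torus_proj P (a' +i* b') -> seg a b v w = seg a' b' v w.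
Proof.
move=> /torus_projP [m [n [-> ->]]]; apply/funext => t.
by apply/torus_projP; exists m, n; apply/eqP; rewrite eq_complex /=;
  apply/andP; split; apply/eqP; ring.
Qed.

(** Cut the parallelogram spanned by (a, b) and the period (v, w) along its diagonal. The two sides
    parallel to (a, b) project to the same simplex and cancel. *)
Lemma boundary1_base a b (m n : int) :
  let v := P *~ m in let w := (pi *+ 2) *~ n in
  @boundary1 R _ (gen (seg a b v w) - gen (seg 0 0 v w)).
Proof.
move=> v w.
have h1 := boundary1_triangle 0 0 a b v w.
have h2 := boundary1_triangle 0 0 v w a b.
rewrite !add0r [a + v]addrC [b + w]addrC in h1; rewrite !add0r in h2.
rewrite (@eq_seg v w 0 0) in h2; last first.
  by apply/torus_projP; exists m, n; apply/eqP; rewrite eq_complex /= !add0r !eqxx.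
have := boundary1B _ _ h1 h2; congr boundary1.
by apply/funext => s; rewrite !chainE; ring.
Qed.

(** Period segments from the origin are additive modulo boundaries: put the second at the end of the
    first by [boundary1_base] and close the triangle. Linearity in each index then reduces to the
    generators. *)
Lemma boundary1_lattice (m n : int) :
  @boundary1 R _ (gen (seg 0 0 (P *~ m) ((pi *+ 2) *~ n)) -
    (gen (gamma1 P) *~ m + gen (gamma1' P) *~ n)).
Proof.
pose L m n : @chain1 R (torus P) := gen (seg 0 0 (P *~ m) ((pi *+ 2) *~ n)).
have LD a b a' b' : boundary1 (L (a + a') (b + b') - L a b - L a' b').
  have h1 := boundary1_triangle 0 0 (P *~ a) ((pi *+ 2) *~ b)
    (P *~ a') ((pi *+ 2) *~ b').
  have h2 := boundary1_base (0 + P *~ a) (0 + (pi *+ 2) *~ b) a' b'.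
  have := boundary1B _ _ h2 h1; congr boundary1.
  by apply/funext => s; rewrite /L !mulrzDr !chainE; ring.
have L1 : gen (gamma1 P) = L 1 0.
  by congr gen; apply/funext => t; rewrite /gamma1 /seg mulr0z mulr1z mulr0 !add0r.
have L2 : gen (gamma1' P) = L 0 1.
  by congr gen; apply/funext => t; rewrite /gamma1' /seg mulr0z mulr1z mulr0 !add0r.
have h1 := boundary1_linear (fun m => L m 0) m (fun i j => LD i 0 j 0).
have h2 := boundary1_linear (fun n => L 0 n) n (fun i j => LD 0 i 0 j).
have h3 := LD m 0 0 n; rewrite addr0 add0r in h3.
have := boundary1D _ _ h3 (boundary1D _ _ h1 h2); rewrite L1 L2.
congr boundary1; apply/funext => s; rewrite -/(L m n) !chainE; ring.
Qed.

Lemma homology_coords_lift (gamma : R -> torus P) x y (m n : int) :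
    continuous x -> continuous y ->
    (forall t, simplex1 t -> gamma t = torus_proj P (x t +i* y t)) ->
    x 1 - x 0 = P *~ m -> y 1 - y 0 = (pi *+ 2) *~ n ->
  homology_coords gamma m n.
Proof.
move=> cx cy gE xm yn; rewrite /homology_coords (eq_gen _ _ gE).
have := boundary1_straighten x y cx cy; rewrite xm yn => h1.
have := boundary1D _ _ (boundary1D _ _ h1 (boundary1_base (x 0) (y 0) m n))
  (boundary1_lattice m n).
congr boundary1; apply/funext => s; rewrite !chainE; ring.
Qed.

End TorusHomology.

(** * Increments of lifts *)

Section Increment.
Local Open Scope complex_scope.
Context {R : realType} (P : R) (P0 : P != 0).

(** Otherwise the intermediate value theorem yields a half-integer value. *)
Lemma integer_valued_constant (f : R -> R) : continuous f ->
  (forall t, simplex1 t -> exists m : int, f t = m%:~R) -> f 0 = f 1.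
Proof.
move=> cf fZ; apply: contrapT => /eqP f01.
have [m fm] : exists m : int, f 0 = m%:~R.
  by apply: fZ; rewrite /simplex1 /= in_itv /= lexx ler01.
have [n fn] : exists n : int, f 1 = n%:~R.
  by apply: fZ; rewrite /simplex1 /= in_itv /= lexx ler01.
have half (k i : int) : k%:~R + 2^-1 = i%:~R :> R -> False.
  move=> ki; have h1 : (k < i)%R by rewrite -(ltr_int R) -ki; lra.
  have h2 : (i < k + 1)%R by rewrite -(ltr_int R) -ki intrD; lra.
  by rewrite ltzD1 leNgt h1 in h2.
have between (k l : int) : k < l ->
    (k%:~R <= k%:~R + 2^-1 :> R) && (k%:~R + 2^-1 <= l%:~R :> R).
  move=> kl; have kl1 : (k + 1)%:~R <= l%:~R :> R by rewrite ler_int lezD1.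
  by rewrite intrD in kl1; apply/andP; split; lra.
have mid (k : int) : Num.min (f 0) (f 1) <= k%:~R + 2^-1 <= Num.max (f 0) (f 1) ->
    False.
  move=> kb; have [c c01 fc] := IVT (ler01 : (0 : R) <= 1) (continuous_subspaceT cf) kb.
  have [i fi] := fZ c c01.
  by apply: (half k i); rewrite -fc fi.
move: f01; rewrite neq_lt => /orP[lt|lt].
  apply: (mid m); rewrite (min_l (ltW lt)) (max_r (ltW lt)) fm fn.
  by apply: between; rewrite -(ltr_int R) -fm -fn.
apply: (mid n); rewrite (min_r (ltW lt)) (max_l (ltW lt)) fm fn.
by apply: between; rewrite -(ltr_int R) -fm -fn.
Qed.

(** Only the real part of the lift is required to be continuous; it already determines the
    increment, since lifts of one point have real parts that differ by multiples of P. *)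
Definition increment (s : R -> torus P) (r : R) : Prop :=
  exists2 x : R -> R, continuous x &
    (forall t, simplex1 t -> exists y, s t = torus_proj P (x t +i* y)) /\
    r = x 1 - x 0.

Lemma increment_unique s r r' : increment s r -> increment s r' -> r = r'.
Proof.
move=> [x cx [xs ->]] [x' cx' [xs' ->]].
have : (x 0 - x' 0) / P = (x 1 - x' 1) / P.
  apply: (integer_valued_constant (fun t => (x t - x' t) / P)).
    have cst : continuous (fun _ : R => P^-1) by exact: continuous_cst_fun.
    by refine (continuous_mulfun _ _
      (continuous_addfun _ _ cx (continuous_oppfun _ cx')) cst).
  move=> t t1; have [y sy] := xs t t1; have [y' ] := xs' t t1.
  rewrite sy => /torus_projP.
  move=> [m [n [-> _]]]; exists m.
  by rewrite addrC addKr -(mulrzr P) mulrAC divff// mul1r.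
by move/(mulIf (invr_neq0 P0)); lra.
Qed.

Lemma increment_ext s s' r : (forall t, simplex1 t -> s t = s' t) ->
  increment s r -> increment s' r.
Proof.
move=> ss [x cx [xs ->]]; exists x => //; split => // t t1.
by rewrite -ss//; exact: xs.
Qed.

(** A total function, as [chain_functional] requires; 0 is the value on functions without a lift. *)
Let F s : R := xget 0 (increment s).

Let FE s r : increment s r -> F s = r.
Proof.
by move=> sr; exact: increment_unique (xgetI 0 sr) sr.
Qed.

Let F_ext s s' : (forall t, simplex1 t -> s t = s' t) -> F s = F s'.
Proof.
move=> ss; rewrite /F; congr (xget _ _); apply/seteqP.
by split=> r; apply: increment_ext => // t t1; rewrite ss.
Qed.

(** A lift of the whole 2-simplex restricts to lifts of its edges, and the differences of its values
    at the vertices telescope. *)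
Let F_bd2 (s : R * R -> torus P) : singular2 s ->
  F (fun t => s (1 - t, t)) - F (fun t => s (0, t)) + F (fun t => s (t, 0)) = 0.
Proof.
move=> cs; have [x [y [cx cy xys]]] := torus_lift _ _ _ _ P0 liftable_simplex2 cs.
have edge (a b : R -> R) : continuous a -> continuous b ->
    (forall t, simplex1 t -> simplex2 (a t, b t)) ->
    F (fun t => s (a t, b t)) = x (a 1, b 1) - x (a 0, b 0).
  move=> ca cb ab; apply: FE; exists (fun t => x (a t, b t)).
    exact: (continuous_compfun _ _ (continuous_pairfun _ _ ca cb) cx).
  by split => // t /ab abt; exists (y (a t, b t)); rewrite xys.
have cst (k : R) : continuous (fun _ : R => k) by exact: continuous_cst_fun.
have cid : continuous (fun t : R => t) by exact: continuous_id_fun.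
have c1 : continuous (fun t : R => 1 - t).
  by refine (continuous_addfun _ _ (cst 1) (continuous_oppfun _ cid)).
rewrite (edge _ _ c1 cid) ?(edge _ _ (cst 0) cid) ?(edge _ _ cid (cst 0)).
- by rewrite subrr subr0; ring.
all: by move=> t; rewrite /simplex1 /= in_itv /= => /andP[t0 t1]; split => /=; lra.
Qed.

(** Apply the linear extension of [F] to the homology: boundaries go to 0, [gamma1] to P and
    [gamma1'] to 0. *)
Lemma homology_coords_increment (gamma : R -> torus P) (x : R -> R) (m n : int) :
    homology_coords gamma m n -> continuous x ->
    (forall t, simplex1 t -> exists y, gamma t = torus_proj P (x t +i* y)) ->
  x 1 - x 0 = P *~ m.
Proof.
move=> [N [k [s [ss E]]]] cx xg.
(* All the 1-simplices that occur in this homology. *)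
pose l := [:: gamma; gamma1 P; gamma1' P] ++
  flatten [seq [:: (fun t => s i (1 - t, t)); (fun t => s i (0, t));
                   (fun t => s i (t, 0))] | i <- enum 'I_N].
have [L [LD LM LF]] := chain_functional F l F_ext.
have LN c : L (- c) = - L c by rewrite -[- c]mulr1z mulNrz -mulrNz LM mulrNz mulr1z.
have lE i t : t \in [:: (fun t => s i (1 - t, t)); (fun t => s i (0, t));
                        (fun t => s i (t, 0))] -> t \in l.
  move=> ti; rewrite mem_cat; apply/orP; right; apply/flattenP; eexists; last exact: ti.
  by apply/mapP; exists i; rewrite ?mem_enum.
have Lsum : L (\sum_(i < N) bd2 (s i) *~ k i) = 0.
  apply: (big_ind (fun c => L c = 0)).
  - by rewrite -(mulr0z 0) LM mulr0z.
  - by move=> c d c0 d0; rewrite LD c0 d0 addr0.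
  - move=> i _; rewrite LM /bd2 !LD LN !LF ?F_bd2 ?mul0rz//;
      by apply: (lE i); rewrite !inE eqxx ?orbT.
have := congr1 L E; rewrite Lsum LD LN LD !LM !LF; last 3 first.
- by rewrite mem_cat !inE eqxx ?orbT.
- by rewrite mem_cat !inE eqxx ?orbT.
- by rewrite mem_cat !inE eqxx ?orbT.
have -> : F gamma = x 1 - x 0 by apply: FE; exists x.
have -> : F (gamma1 P) = P.
  apply: FE; exists (fun t => t * P).
    by refine (continuous_mulfun _ _ continuous_id_fun (continuous_cst_fun P)).
  by split; [move=> t _; exists 0|rewrite mul1r mul0r subr0].
have -> : F (gamma1' P) = 0.
  apply: FE; exists (fun=> 0); first exact: continuous_cst_fun.
  by split; [move=> t _; exists (t * (pi *+ 2))|rewrite subr0].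
by rewrite mul0rz addr0 => /eqP; rewrite subr_eq0 => /eqP.
Qed.

End Increment.

(** * Components of plane open sets *)

Section PlaneComponents.
Local Open Scope complex_scope.
Context {R : realType}.
Implicit Types (z w u : R[i]) (A : set R[i]) (x y : R -> R).
Local Notation Re := (@complex.Re R).
Local Notation Im := (@complex.Im R).

(** Path-connection in coordinates continuous on all of [R], so that paths can be scaled and
    reparametrised without subspace topologies. *)
Definition joined A z w : Prop := exists x y : R -> R,
  [/\ continuous x, continuous y, x 0 +i* y 0 = z, x 1 +i* y 1 = w &
      forall t, simplex1 t -> A (x t +i* y t)].

Lemma joined_refl A z : A z -> joined A z z.
Proof.
move=> Az; exists (fun=> Re z), (fun=> Im z).
by case: z Az => a b; split => //; exact: continuous_cst_fun.
Qed.

Lemma joined_segment A z w u : joined A z w ->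
  (forall s, simplex1 s ->
     A ((Re w + s * (Re u - Re w)) +i* (Im w + s * (Im u - Im w)))) ->
  joined A z u.
Proof.
move=> [x [y [cx cy x0 x1 xyA]]] wu.
(* [a] runs the path during the first half of [0, 1] and then waits; [b] waits and then runs the
   segment. Adding the two motions avoids gluing continuous functions. *)
pose a (t : R) : R := Num.min (2 * t) 1.
pose b (t : R) : R := Num.max (2 * t - 1) 0.
have cst (k : R) : continuous (fun _ : R => k) by exact: continuous_cst_fun.
have c2 : continuous (fun t : R => 2 * t).
  by refine (continuous_mulfun _ _ (cst 2) continuous_id_fun).
have ca : continuous a by refine (continuous_minfun _ _ c2 (cst 1)).
have cb : continuous b.
  by refine (continuous_maxfun _ _
    (continuous_addfun _ _ c2 (continuous_oppfun _ (cst 1))) (cst 0)).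
have cf (f : R -> R) (k : R) : continuous f ->
    continuous (fun t => f (a t) + b t * k).
  move=> cf; by refine (continuous_addfun _ _ (continuous_compfun _ _ ca cf)
    (continuous_mulfun _ _ cb (cst k))).
have a0 : a 0 = 0 by rewrite /a mulr0 min_l.
have b0 : b 0 = 0 by rewrite /b mulr0 sub0r max_r// lerN10.
have a1 : a 1 = 1 by rewrite /a min_r// mulr1; lra.
have b1 : b 1 = 1 by rewrite /b max_l; lra.
exists (fun t => x (a t) + b t * (Re u - Re w)),
  (fun t => y (a t) + b t * (Im u - Im w)); split.
- exact: cf.
- exact: cf.
- by rewrite a0 b0 !mul0r !addr0.
- rewrite a1 b1 -x1 /= !mul1r ![_ + (_ - _)]addrC !subrK.
  by case: (u).
- move=> t; rewrite /simplex1 /= in_itv /= => /andP[t0 t1].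
  have [h|h] := leP (2 * t) 1.
    have -> : a t = 2 * t by rewrite /a min_l.
    have -> : b t = 0 by rewrite /b max_r//; lra.
    rewrite !mul0r !addr0; apply: xyA; rewrite /simplex1 /= in_itv /=.
    by apply/andP; split; lra.
  have -> : a t = 1 by rewrite /a min_r// ltW.
  have -> : b t = 2 * t - 1 by rewrite /b max_l//; lra.
  have -> : x 1 = Re w by rewrite -x1.
  have -> : y 1 = Im w by rewrite -x1.
  by apply: wu; rewrite /simplex1 /= in_itv /=; apply/andP; split; lra.
Qed.

Lemma joined_connected_component A z w :
  joined A z w -> connected_component A z w.
Proof.
move=> [x [y [cx cy <- <- xyA]]].
have cg : continuous (fun t => x t +i* y t).
  by move=> t; exact: (continuous_Complex x y t (cx t) (cy t)).
apply: (@connected_component_max _ _ ((fun t => x t +i* y t) @` `[0, 1])).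
- by exists 0 => //=; rewrite in_itv /= lexx ler01.
- by move=> _ [t t1 <-]; exact: xyA.
- apply: connected_continuous_connected; first exact: segment_connected.
  exact: continuous_subspaceT.
- by exists 1 => //=; rewrite in_itv /= lexx ler01.
Qed.

Lemma open_box A z : open A -> A z -> exists2 e : R, 0 < e &
  forall w, `|Re w - Re z| < e -> `|Im w - Im z| < e -> A w.
Proof.
by move=> Ao Az; apply/nbhs_box; exact: open_nbhs_nbhs.
Qed.

(** The points joined to z and the other points of [A] both form open sets, because boxes are
    star-shaped about their centres; the component of z therefore meets only the first. *)
Lemma connected_component_joined A z w : open A ->
  connected_component A z w -> joined A z w.
Proof.
move=> Ao zw.
have Az : A z.
  by apply: contrapT => nAz; rewrite connected_component_out in zw.
(* The segment stays in the box about [a] in both directions: away from [a] for openness of the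
   joined set, back to [a] for openness of the rest. *)
have dist (a b s e : R) : simplex1 s -> `|b - a| < e -> `|a + s * (b - a) - a| < e /\
    `|b + s * (a - b) - a| < e.
  rewrite /simplex1 /= in_itv /= => /andP[s0 s1] ab.
  have h t : 0 <= t <= 1 -> `|t * (b - a)| < e.
    move=> /andP[t0 t1]; apply: le_lt_trans ab.
    by rewrite normrM ger0_norm// ler_piMl.
  split.
    by rewrite (_ : _ - a = s * (b - a)) ?h ?s0//; ring.
  rewrite (_ : _ - a = (1 - s) * (b - a)) ?h//; last by ring.
  by apply/andP; split; lra.
have Jo : open [set u | joined A z u].
  rewrite openE => u Ju; apply/nbhs_box.
  have Au : A u by case: Ju => x [y [_ _ _ <-]]; apply; rewrite /simplex1 /= in_itv /= lexx ler01.
  have [e e0 eA] := open_box _ _ Ao Au; exists e => // v vr vi.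
  apply: (joined_segment _ _ _ _ Ju) => s s1; apply: eA => /=.
    by have [] := dist _ _ _ _ s1 vr.
  by have [] := dist _ _ _ _ s1 vi.
have NJo : open [set u | A u /\ ~ joined A z u].
  rewrite openE => u [Au nJu]; apply/nbhs_box.
  have [e e0 eA] := open_box _ _ Ao Au; exists e => // v vr vi.
  split; first exact: eA.
  move=> Jv; apply: nJu; apply: (joined_segment _ _ _ _ Jv) => s s1; apply: eA => /=.
    by have [] := dist _ _ _ _ s1 vr.
  by have [] := dist _ _ _ _ s1 vi.
have sub := @connected_component_sub _ A z.
suff E : connected_component A z `&` [set u | joined A z u] =
    connected_component A z by rewrite -E in zw; case: zw.
apply: (@component_connected _ A z).
- by exists z; split; [exact: connected_component_refl|exact: joined_refl].
- by exists [set u | joined A z u].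
- exists (~` [set u | A u /\ ~ joined A z u]); first exact: open_closedC.
  apply/seteqP; split=> u [zu Ju]; split => //=; first by case.
  by apply: contrapT => nJu; apply: Ju; split => //; exact: sub.
Qed.

Lemma connected_component_nbhs A z : open A -> A z ->
  nbhs z (connected_component A z).
Proof.
move=> Ao Az; apply/nbhs_box; have [e e0 eA] := open_box _ _ Ao Az.
exists e => // w wr wi; apply: joined_connected_component.
apply: (joined_segment _ _ _ _ (joined_refl _ _ Az)) => s.
rewrite /simplex1 /= in_itv /= => /andP[s0 s1].
by apply: eA; rewrite /= addrC addKr normrM ger0_norm//;
  [apply: le_lt_trans wr|apply: le_lt_trans wi]; rewrite ler_piMl.
Qed.

Lemma open_connected_component A z : open A -> open (connected_component A z).
Proof.
move=> Ao; rewrite openE => w zw.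
rewrite /interior (same_connected_component zw).
by apply: connected_component_nbhs => //; exact: connected_component_sub zw.
Qed.

End PlaneComponents.

(** * Components of the lifted domain *)

Section LiftedComponents.
Local Open Scope complex_scope.
Context {R : realType} (T : R) (T1 : 1 < T) (D : set (torus (ln T)))
  (Dd : domain D).
Implicit Types (z w u : R[i]).
Local Notation Re := (@complex.Re R).
Local Notation Im := (@complex.Im R).

Let A : set R[i] := phi_preimage D.
Let E z w : Prop := connected_component A z w.
Let dil (m : int) z : R[i] := (T ^ m)%:C * z.

Let T0 : 0 < T. Proof. exact: lt_trans T1. Qed.
Let P0 : ln T != 0. Proof. by rewrite gt_eqF// ln_gt0. Qed.
Let Dopen : open D. Proof. by case: Dd. Qed.

Let dil0 z : dil 0 z = z. Proof. by rewrite /dil expr0z mul1r. Qed.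

Let dilD m n z : dil m (dil n z) = dil (m + n) z.
Proof. by rewrite /dil mulrA -rmorphM -expfzDr// gt_eqF. Qed.

Let dil_Complex m (a b : R) : dil m (a +i* b) = (T ^ m * a) +i* (T ^ m * b).
Proof. by apply/eqP; rewrite eq_complex /= !mul0r subr0 addr0 !eqxx. Qed.

Let Tm0 m : (T ^ m)%:C != 0 :> R[i].
Proof. by rewrite eq_complex /= eqxx andbT expfz_neq0// gt_eqF. Qed.

Let A_dil m z : A z -> A (dil m z).
Proof.
move=> [z0 Dz]; have dz0 : dil m z != 0 by rewrite mulf_neq0.
split => //; rewrite (_ : phi _ _ = phi (ln T) z)//.
by apply/(phi_eq _ _ _ T0 dz0 z0); exists m.
Qed.

Let A_cexp w : A (cexp w) <-> D (torus_proj (ln T) w).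
Proof.
rewrite -phi_cexp; split; first by case.
by split => //; exact: cexp_neq0.
Qed.

Let Aopen : open A.
Proof.
rewrite openE => z [z0 Dz].
have [l [_ _ lE]] := local_clog z z0.
have nD : nbhs (phi (ln T) z) D by exact: open_nbhs_nbhs.
have h := continuous_phi (ln T) z z0 D nD.
by apply: filterS2 lE h => u [u0 _] Du; split.
Qed.

Let E_refl z : A z -> E z z. Proof. exact: connected_component_refl. Qed.
Let E_sym z w : E z w -> E w z. Proof. exact: connected_component_sym. Qed.
Let E_trans w z u : E z w -> E w u -> E z u.
Proof. exact: connected_component_trans. Qed.
Let E_A z w : E z w -> A z /\ A w.
Proof.
by move=> h; split; [exact: connected_component_sub (E_sym _ _ h)
  | exact: connected_component_sub h].
Qed.

Let E_dil m z w : E z w -> E (dil m z) (dil m w).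
Proof.
move=> /(connected_component_joined _ _ _ Aopen) [x [y [cx cy <- <- xyA]]].
apply: joined_connected_component.
exists (fun t => T ^ m * x t), (fun t => T ^ m * y t); split.
- by refine (continuous_mulfun _ _ (continuous_cst_fun (T ^ m)) cx).
- by refine (continuous_mulfun _ _ (continuous_cst_fun (T ^ m)) cy).
- by rewrite dil_Complex.
- by rewrite dil_Complex.
- by move=> t /xyA; rewrite -dil_Complex; exact: A_dil.
Qed.

(** [V] is saturated for [phi], so the image lifts through [torus_proj] to the preimage of [V] under
    the continuous map [cexp]. *)
Let open_phi_image (V : set R[i]) : open V -> V `<=` A ->
    (forall m u, V u -> V (dil m u)) ->
  open [set d | exists2 u, V u & phi (ln T) u = d].
Proof.
move=> Vo VA Vdil.
suff h : open (torus_proj (ln T) @^-1`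
  [set d | exists2 u, V u & phi (ln T) u = d]) by exact: h.
rewrite (_ : _ @^-1` _ = cexp @^-1` V).
  by apply: open_comp => // w _; exact: continuous_cexp.
apply/seteqP; split => w /=.
  move=> [u Vu]; rewrite -phi_cexp => /esym.
  have [u0 _] := VA _ Vu.
  by move=> /(phi_eq _ _ _ T0 (cexp_neq0 w) u0) [m ->]; exact: Vdil.
by move=> Vw; exists (cexp w) => //; exact: phi_cexp.
Qed.

(** [V1] collects the components of the dilates of z, and [V2] is the rest of [A]. Both are open and
    invariant under dilations, so their images are disjoint open sets covering D, and connectedness
    leaves only the first. *)
Let cover z w : A z -> A w -> exists m, E (dil m z) w.
Proof.
move=> Az Aw.
pose V1 := [set u | exists m, E (dil m z) u].
pose V2 := [set u | A u /\ forall m, ~ E (dil m z) u].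
have V1A : V1 `<=` A by move=> u [m /E_A []].
have V2A : V2 `<=` A by move=> u [].
have V1o : open V1.
  rewrite openE => u [m mu]; have [_ Au] := E_A _ _ mu.
  apply: filterS (connected_component_nbhs _ _ Aopen Au) => v uv.
  by exists m; exact: E_trans mu uv.
have V2o : open V2.
  rewrite openE => u [Au mu].
  apply: filterS (connected_component_nbhs _ _ Aopen Au) => v uv.
  split; first by have [] := E_A _ _ uv.
  by move=> m mv; apply: (mu m); exact: E_trans mv (E_sym _ _ uv).
have V1dil m u : V1 u -> V1 (dil m u).
  by move=> [n nu]; exists (m + n); rewrite -dilD; exact: E_dil.
have V2dil m u : V2 u -> V2 (dil m u).
  move=> [Au nu]; split; first exact: A_dil.
  move=> n /(E_dil (- m)); rewrite !dilD addNr dil0; exact: nu.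
have U1o := open_phi_image _ V1o V1A V1dil.
have U2o := open_phi_image _ V2o V2A V2dil.
set U1 := [set d | _] in U1o; set U2 := [set d | _] in U2o.
have U12 d : U1 d -> U2 d -> False.
  move=> [u V1u ud] [v V2v vd].
  have [u0 _] := V1A _ V1u; have [v0 _] := V2A _ V2v.
  have [m vE] : exists m : int, v = dil m u.
    by apply/(phi_eq _ _ _ T0 v0 u0); rewrite ud vd.
  have [k ku] := V1dil m _ V1u.
  by move: V2v; rewrite vE => -[_ /(_ k)].
have U1D d : U1 d -> D d by move=> [u /V1A [_ Du] <-].
have U1U2 d : D d -> ~ U2 d -> U1 d.
  have [v ->] := torus_proj_surj _ d => Dv nU2.
  exists (cexp v); last exact: phi_cexp.
  apply: contrapT => nV1; apply: nU2; exists (cexp v); last exact: phi_cexp.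
  split; first exact/A_cexp.
  by move=> m mv; apply: nV1; exists m.
have U1E : U1 = D.
  case: Dd => _ _; apply.
  - by exists (phi (ln T) z), z => //; exists 0; rewrite dil0; exact: E_refl.
  - by exists U1 => //; apply/seteqP; split=> d // => [h|[]//]; split => //; exact: U1D.
  - exists (~` U2); first exact: open_closedC.
    apply/seteqP; split=> d /=; last by case; exact: U1U2.
    by move=> h; split; [exact: U1D|move=> h2; exact: U12 h h2].
have [w0 Dw] := Aw; rewrite -U1E in Dw.
have [u [m mu] uw] := Dw; have [_ [u0 _]] := E_A _ _ mu.
have [k ->] : exists k : int, w = dil k u.
  by apply/(phi_eq _ _ _ T0 w0 u0).
by exists (k + m); rewrite -dilD; exact: E_dil.
Qed.

(** The log-modulus and a lifted argument of a path from z to T^n z are coordinates of a lift of a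
    closed curve in D. *)
Let n1_of_loop z n : E z (dil n z) -> n1_values D n.
Proof.
move=> /(connected_component_joined _ _ _ Aopen) [x [y [cx cy z0 z1 xyA]]].
(* Clamping to [0, 1] keeps the path in [A], hence away from 0, for every real t; modulus, inverse
   and logarithm are then continuous on all of [R]. *)
pose r (t : R) : R := Num.max 0 (Num.min t 1).
have cst (k : R) : continuous (fun _ : R => k) by exact: continuous_cst_fun.
have cr : continuous r.
  by refine (continuous_maxfun _ _ (cst 0)
    (continuous_minfun _ _ continuous_id_fun (cst 1))).
have rs t : simplex1 (r t).
  rewrite /simplex1 /r /= in_itv /= le_max lexx /=.
  by rewrite ge_max ler01 ge_min lexx orbT.
have rK t : simplex1 t -> r t = t.
  by rewrite /simplex1 /r /= in_itv /= => /andP[t0 t1]; rewrite min_l// max_r.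
pose g t : R[i] := x (r t) +i* y (r t).
have gA t : A (g t) by exact: xyA.
have g0 t : g t != 0 by case: (gA t).
pose rho t := Normc.normc (g t).
have rho0 t : 0 < rho t by exact: normc_gt0.
have cg : continuous g.
  move=> t; apply: (continuous_Complex (x \o r) (y \o r)).
    exact: (continuous_compfun _ _ cr cx).
  exact: (continuous_compfun _ _ cr cy).
have crho : continuous rho by exact: (continuous_compfun _ _ cg continuous_normc).
have cV : continuous (fun t => (rho t)^-1).
  move=> t; have FF : Filter (nbhs t) by exact: nbhs_filter.
  exact: (@cvgV _ _ _ _ rho (rho t) (lt0r_neq0 (rho0 t)) (crho t)).
have [|||th cth thE] := circle_lift R simplex1
    (fun t => Re (g t) / rho t) (fun t => Im (g t) / rho t) liftable_simplex1.
- by refine (continuous_mulfun _ _ (continuous_compfun _ _ cg continuous_Re) cV).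
- by refine (continuous_mulfun _ _ (continuous_compfun _ _ cg continuous_Im) cV).
- by move=> t; exact: normc_unit.
have cl : continuous (fun t => ln (rho t)).
  by move=> t; apply: (continuous_comp (crho t)); exact: continuous_ln.
have gE t : simplex1 t -> g t = cexp (ln (rho t) +i* th t).
  move=> t1; have [ct st] := thE t t1.
  rewrite /cexp /= lnK ?posrE//.
  rewrite -ct -st ![rho t * _]mulrC !divfK ?gt_eqF//.
have s0 : simplex1 (0 : R) by rewrite /simplex1 /= in_itv /= lexx ler01.
have s1 : simplex1 (1 : R) by rewrite /simplex1 /= in_itv /= lexx ler01.
have g1 : g 1 = dil n (g 0).
  by rewrite /g !rK// z0 z1.
have Tn0 : 0 < T ^ n by exact: exprz_gt0.
have rhoT : rho 1 = T ^ n * rho 0.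
  rewrite /rho g1 Normc.normcM; congr (_ * _).
  by rewrite /= expr0n /= addr0 sqrtr_sqr gtr0_norm.
have rho1 : ln (rho 1) = ln (rho 0) + ln T *~ n.
  by rewrite rhoT lnM ?posrE// addrC -[T in T ^ n]lnK ?posrE// -expRMz expRK.
(* A positive dilation preserves the argument, so both ends have the same cosine and sine. *)
have [b bE] : exists b : int, th 1 = th 0 + (pi *+ 2) *~ b.
  have [c1 s1'] := thE 1 s1; have [c0 s0'] := thE 0 s0.
  have dilE : Re (dil n (g 0)) = T ^ n * Re (g 0) /\
              Im (dil n (g 0)) = T ^ n * Im (g 0) by rewrite dil_Complex.
  apply: cos_sin_eq.
    by rewrite -c1 -c0 rhoT g1 dilE.1 -mulf_div divff ?mul1r// gt_eqF.
  by rewrite -s1' -s0' rhoT g1 dilE.2 -mulf_div divff ?mul1r// gt_eqF.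
exists (fun t => torus_proj (ln T) (ln (rho t) +i* th t)), b; split.
  split.
  - apply: continuous_subspaceT.
    apply: (continuous_compfun _ _ _ (continuous_torus_proj (ln T))).
    by move=> t; exact: (continuous_Complex _ _ t (cl t) (cth t)).
  - apply/esym/torus_projP; exists n, b.
    by rewrite rho1 bE.
  - by move=> t t1; apply/A_cexp; rewrite -gE.
apply: (homology_coords_lift _ _ (fun t => ln (rho t)) th) => //.
- by rewrite rho1 addrC addKr.
- by rewrite bE addrC addKr.
Qed.

(** The exponential of a lift of the curve joins some point of [A] to its dilate by T^n; [cover]
    carries this relation over to z. *)
Let loop_of_n1 z n : A z -> n1_values D n -> E z (dil n z).
Proof.
move=> Az [gamma [n' [[cg g01 gD] gn]]].
have [x [y [cx cy xyE]]] := torus_lift _ _ _ _ P0 liftable_simplex1 cg.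
have xn : x 1 - x 0 = ln T *~ n.
  by apply: (homology_coords_increment _ P0 _ _ _ _ gn cx) => t /xyE ->; exists (y t).
have s0 : simplex1 (0 : R) by rewrite /simplex1 /= in_itv /= lexx ler01.
have s1 : simplex1 (1 : R) by rewrite /simplex1 /= in_itv /= lexx ler01.
pose l t : R[i] := x t +i* y t.
have cl : continuous (fun t => cexp (l t)).
  apply: (continuous_compfun _ _ _ continuous_cexp).
  by move=> t; exact: (continuous_Complex _ _ t (cx t) (cy t)).
have El : E (cexp (l 0)) (cexp (l 1)).
  apply: joined_connected_component.
  exists (fun t => Re (cexp (l t))), (fun t => Im (cexp (l t))); split => //.
  - exact: (continuous_compfun _ _ cl continuous_Re).
  - exact: (continuous_compfun _ _ cl continuous_Im).
  - move=> t t1; suff : A (cexp (l t)) by [].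
    by apply/A_cexp; rewrite -xyE//; exact: gD.
have [m [k lk]] : exists m k : int, l 1 = l 0 + ((ln T *~ m) +i* ((pi *+ 2) *~ k)).
  by apply/torus_projP; rewrite -!xyE.
have mn : ln T *~ m = ln T *~ n.
  by case: lk => x1 _; rewrite -xn x1 addrC addKr.
rewrite lk mn cexpD// -/(dil n _) in El.
have [A0 _] := E_A _ _ El.
have [j jE] := cover _ _ Az A0.
(* This joins [dil j z] to [dil n (dil j z)]; dilations commute, so T^j can be divided out. *)
have := E_trans _ _ _ jE (E_trans _ _ _ El (E_sym _ _ (E_dil n _ _ jE))).
move=> /(E_dil (- j)); rewrite !dilD addNr dil0.
by rewrite (_ : _ + _ = n)//; ring.
Qed.

Lemma open_phi_preimage : open (phi_preimage D).
Proof. exact: Aopen. Qed.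

Lemma phi_preimage_dilation (m : int) z :
  phi_preimage D z -> phi_preimage D ((T ^ m)%:C * z).
Proof. exact: A_dil. Qed.

Lemma dilate_component (m : int) z :
  dilate (T ^ m) (connected_component (phi_preimage D) z) =
    connected_component (phi_preimage D) ((T ^ m)%:C * z).
Proof.
apply/seteqP; split => [_ [w zw <-]|w zw]; first exact: E_dil.
exists (dil (- m) w); last by rewrite -/(dil m _) dilD addrN dil0.
by have := E_dil (- m) _ _ zw; rewrite -/(dil m z) dilD addNr dil0.
Qed.

Lemma component_dilation_n1 z (n : int) : phi_preimage D z ->
  connected_component (phi_preimage D) z ((T ^ n)%:C * z) <-> n1_values D n.
Proof. by move=> Az; split; [exact: n1_of_loop|exact: loop_of_n1]. Qed.

Lemma component_dilations_cover z w : phi_preimage D z -> phi_preimage D w ->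
  exists m : int, connected_component (phi_preimage D) ((T ^ m)%:C * z) w.
Proof. exact: cover. Qed.

End LiftedComponents.

(** * Components as cosets of the group of values of n_1 *)

Theorem proposition0p10 (R : realType) (T : R) (hT : 1 < T)
  (D : set (torus (ln T))) (hD : domain D)
  (hcap : positive_capacity (boundary D)) :
  ((~ exists n : int, n1_values D n /\ n <> 0) ->
     forall G0 : set (complex R), is_component (phi_preimage D) G0 ->
       phi_preimage D = \bigcup_(j in [set: int]) dilate (T ^ j) G0 /\
       (forall j l : int, j <> l ->
          dilate (T ^ j) G0 `&` dilate (T ^ l) G0 = set0)) /\
  ((exists n : int, n1_values D n /\ n <> 0) ->
     exists k : nat,
       [/\ (exists n : int, [/\ n1_values D n, n <> 0 & k = `|n|%N]),
           (forall n : int, n1_values D n -> n <> 0 -> (k <= `|n|)%N) &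
       forall G0 : set (complex R), is_component (phi_preimage D) G0 ->
       exists G : nat -> set (complex R),
         [/\ G 0%N = G0,
             phi_preimage D = \bigcup_(q in [set q : nat | (q < k)%N]) G q,
             (forall q r : nat, (q < k)%N -> (r < k)%N -> q <> r ->
                G q `&` G r = set0),
             (forall q : nat, (q < k)%N -> homogeneous_domain (T ^+ k) (G q)) &
             (forall (m l : int) (q : nat), (q < k)%N ->
                m = l * k%:Z + q%:Z -> dilate (T ^ m) G0 = G q)]]).
Proof.
have T0 : 0 < T by exact: lt_trans hT.
have Topen := open_phi_preimage T D hD.
set A := phi_preimage D in Topen *.
pose dil (m : int) (z : complex R) : complex R := ((T ^ m)%:C)%C * z.
have dil0 z : dil 0 z = z by rewrite /dil expr0z mul1r.
have dilD m n z : dil m (dil n z) = dil (m + n) z.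
  by rewrite /dil mulrA -rmorphM -expfzDr// gt_eqF.
pose E (z w : complex R) : Prop := connected_component A z w.
have E_sym z w : E z w -> E w z by exact: connected_component_sym.
have E_trans z w u : E z w -> E w u -> E z u by exact: connected_component_trans.
have dilE m z : dilate (T ^ m) (connected_component A z) =
    connected_component A (dil m z) by exact: dilate_component.
have E_dil m z w : E z w -> E (dil m z) (dil m w).
  by move=> zw; rewrite /E -dilE; exists w.
have EN z n : A z -> E z (dil n z) <-> n1_values D n.
  by move=> Az; exact: component_dilation_n1.
have cover z w : A z -> A w -> exists m, E (dil m z) w.
  exact: component_dilations_cover.
(* Two dilates of z share a component exactly when their exponents are congruent modulo the values
   of n_1. *)
have EE z i j : A z -> E (dil i z) (dil j z) <-> n1_values D (j - i).
  move=> Az; rewrite -(EN z)//; split.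
    by move=> /(E_dil (- i)); rewrite !dilD addNr dil0 addrC.
  by move=> /(E_dil i); rewrite dilD subrKC.
split.
  move=> noloop _ [z Az ->]; split.
    apply/seteqP; split=> [w Aw|w [j _]].
      by have [m mw] := cover z w Az Aw; exists m => //; rewrite dilE.
    by rewrite dilE; exact: connected_component_sub.
  (* A common point of the two dilates would make the nonzero integer [l - j] a value of n_1. *)
  move=> j l jl; rewrite !dilE; apply/seteqP; split=> // w [jw lw]; apply: noloop.
  exists (l - j); split; first exact/(EE z)/E_trans/E_sym/lw.
  by apply/eqP; rewrite subr_eq0; apply/eqP => lj; exact: jl.
move=> [n0 [n0v n00]].
have exk : exists k, `[< exists n : int, [/\ n1_values D n, n <> 0 & k = `|n|%N] >].
  by exists `|n0|%N; apply/asboolP; exists n0.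
case: (ex_minnP exk) => k /asboolP [nk [nkv nk0 kE]] kmin; exists k.
have kmin' n : n1_values D n -> n <> 0 -> (k <= `|n|)%N.
  by move=> nv n_0; apply: kmin; apply/asboolP; exists n.
split; [by exists nk|exact: kmin'|].
have k0 : (0 < k)%N by rewrite kE absz_gt0; apply/eqP.
move=> _ [z Az ->].
(* The group laws come from transitivity, symmetry and reflexivity of [E] at z, not from operations
   on curves. *)
have nD m n : n1_values D m -> n1_values D n -> n1_values D (m + n).
  by move=> /(EN z _ Az) mv /(EN z _ Az) /(E_dil m) nv; apply/(EN z)=> //;
    rewrite -dilD; exact: E_trans mv nv.
have nN m : n1_values D m -> n1_values D (- m).
  move=> /(EN z _ Az) /(E_dil (- m)); rewrite dilD addNr dil0 => /E_sym.
  by move=> /(EN z _ Az).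
have n_0 : n1_values D 0 by apply/(EN z) => //;
  rewrite dil0; exact: connected_component_refl.
have nk' : n1_values D k%:Z.
  by rewrite kE; case: nk nkv {nk0 kE} => // m; rewrite NegzE abszN; exact: nN.
have nMz l : n1_values D (l * k%:Z).
  have h (j : nat) : n1_values D (j%:Z * k%:Z).
    elim: j => [|j IH]; first by rewrite mul0r.
    by rewrite (_ : _ * _ = j%:Z * k%:Z + k%:Z); [exact: nD|rewrite -addn1 PoszD; ring].
  by case: l => j; rewrite ?NegzE ?mulNr; [exact: h|apply: nN; exact: h].
(* A nonzero difference of two remainders has absolute value below the minimum k. *)
have small (q r : nat) : (q < k)%N -> (r < k)%N -> q <> r ->
    ~ n1_values D (r%:Z - q%:Z).
  move=> qk rk qr /kmin'; lia.
exists (fun q => dilate (T ^+ q) (connected_component A z)).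
have GE q : dilate (T ^+ q) (connected_component A z) = connected_component A (dil q z).
  by rewrite -dilE.
have reduce m l (q : nat) : m = l * k%:Z + q%:Z ->
    connected_component A (dil m z) = connected_component A (dil q z).
  by move=> mE; apply/same_connected_component/(EE z) => //;
    rewrite mE opprD addrCA subrr addr0 -mulNr.
split.
- by rewrite GE dil0.
- apply/seteqP; split=> [w Aw|w [q _]]; last first.
    by rewrite GE; exact: connected_component_sub.
  (* Euclidean division of [m] by k, with nonnegative remainder, selects the piece that contains
     [w]. *)
  have [m mw] := cover z w Az Aw.
  have kz : k%:Z != 0 by rewrite eqz_nat -lt0n.
  have := modz_ge0 m kz; have := ltz_pmod m (k0 : 0 < k%:Z).
  case mq : (m %% k%:Z)%Z => [q|] // qk _.
  exists q => //; rewrite GE -(reduce m (m %/ k%:Z)%Z q)//.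
  by rewrite -mq -divz_eq.
- move=> q r qk rk qr; rewrite !GE; apply/seteqP; split=> // w [qw rw].
  by apply: (small q r qk rk qr); exact/(EE z)/E_trans/E_sym/rw.
- move=> q qk; rewrite GE; split.
  + by rewrite exprn_egt1// -lt0n.
  + have Aq : A (dil q z).
      by exact: phi_preimage_dilation.
    split; first by exists (dil q z); exact: connected_component_refl.
      exact: open_connected_component.
    exact: component_connected.
  (* Dilating [G q] by T^k gives exponent k + q, which is congruent to q modulo k with quotient
     1. *)
  + rewrite (_ : T ^+ k = T ^ k%:Z)// dilE dilD (reduce _ 1 q)//.
    by rewrite mul1r.
- by move=> m l q _ mE; rewrite dilE GE; exact: reduce mE.
Qed.
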